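(* For every $\delta>0$, $$\lim_{N\to\infty}\mathcal{P}_N\Big(\pi\in\mathcal{M}_+ : \inf_{\bar\pi\in\mathcal{E}} d(\pi,\bar\pi)\ge\delta\Big)=0,$$ where $\mathcal{P}_N=\mu_N\circ(\pi^N)^{-1}$ is the law of the empirical measure under the unique stationary state $\mu_N$ of the Glauber–Kawasaki dynamics with generator $\mathcal{L}_N$, and $\mathcal{E}$ is the set of absolutely continuous measures on $\mathbb{T}$ whose density is a classical solution of $(1/2)\Delta\rho+F(\rho)=0$ on $\mathbb{T}$.
   Context: Let $\mathbb{T}_N=\mathbb{Z}/N\mathbb{Z}$ and $X_N=\{0,1\}^{\mathbb{T}_N}$. Fix $M\ge 1$ and a strictly positive cylinder function $c(\eta)=c(\eta(-M),\dots,\eta(M))$, and set $c(x,\eta)=c(\eta(x-M),\dots,\eta(x+M))$ for $x\in\mathbb{T}_N$ ($N$ large enough). The dynamics is the continuous-time Markov process $\eta^N_t$ on $X_N$ with generator $$(\mathcal{L}_N f)(\eta)=\frac{N^2}{2}\sum_{x\in\mathbb{T}_N}[f(\eta^{x,x+1})-f(\eta)]+\sum_{x\in\mathbb{T}_N}c(x,\eta)[f(\eta^x)-f(\eta)],$$ where $\eta^{x,y}$ is $\eta$ with the values at $x$ and $y$ exchanged and $\eta^x$ is $\eta$ with the value at $x$ replaced by $1-\eta(x)$. This process is irreducible on a finite state space; $\mu_N$ denotes its unique invariant probability measure. With $\nu_\rho$ the Bernoulli product measure of density $\rho\in[0,1]$, define $B,D,F:[0,1]\to\mathbb{R}$ by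 $B(\rho)=\int[1-\eta(0)]c(\eta)\,d\nu_\rho$, $D(\rho)=\int\eta(0)c(\eta)\,d\nu_\rho$, $F=B-D$. Let $\mathbb{T}=\mathbb{R}/\mathbb{Z}=[0,1)$ and let $\mathcal{M}_+$ be the space of nonnegative measures on $\mathbb{T}$ with total mass at most $1$, with the weak topology; $\langle\pi,G\rangle=\int_{\mathbb{T}}G\,d\pi$. It is metrized by $d(\pi_1,\pi_2)=\sum_{k\ge0}2^{-k}|\langle\pi_1,f_k\rangle-\langle\pi_2,f_k\rangle|$, where $f_{2k}(u)=\cos(2\pi k u)$ and $f_{2k+1}(u)=\sin(2\pi k u)$, $k\ge0$. The empirical measure is $\pi^N(\eta)=N^{-1}\sum_{x\in\mathbb{T}_N}\eta(x)\delta_{x/N}\in\mathcal{M}_+$, and $\mathcal{P}_N=\mu_N\circ(\pi^N)^{-1}$. A classical solution of $(1/2)\Delta\rho+F(\rho)=0$ on $\mathbb{T}$ is a function $\rho:\mathbb{T}\to[0,1]$ in $C^2(\mathbb{T})$ satisfying the equation at every $u\in\mathbb{T}$ ($\Delta$ is the second derivative). $\mathcal{E}$ is the set of measures $\pi(du)=\rho(u)du$ with $\rho$ such a classical solution. *)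

(* Defs.v *)
From HB Require Import structures.
From mathcomp Require Import all_boot all_order all_algebra.
From mathcomp Require Import all_classical all_reals all_analysis.
From mathcomp Require Import giry.

Set Implicit Arguments.
Unset Strict Implicit.
Unset Printing Implicit Defensive.

Import Order.TTheory GRing.Theory Num.Theory.
Import numFieldNormedType.Exports.

Local Open Scope classical_set_scope.
Local Open Scope ring_scope.

(* X_N = {0,1}^(T_N): the sites of T_N = Z/NZ are 'I_N with the cyclic
   successor ordS. X_N is finite, so every subset is declared measurable. *)
Definition config (N : nat) := {ffun 'I_N -> bool}.

HB.instance Definition _ (N : nat) := Finite.on (config N).
HB.instance Definition _ (N : nat) :=
  isPointed.Build (config N) [ffun=> false].
HB.instance Definition _ (N : nat) :=
  @isMeasurable.Build default_measure_display (config N)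
    (@discrete_measurable (config N))
    (@discrete_measurable0 (config N))
    (@discrete_measurableC (config N))
    (@discrete_measurableU (config N)).

(* A cylinder function of (eta(-M), ..., eta(M)) is a function of a pattern on
   the window {-M, ..., M}; the coordinate i : 'I_(2M+1) is the site i - M. *)
Definition pattern (M : nat) := {ffun 'I_(M.*2.+1) -> bool}.

Definition window_center (M : nat) : 'I_(M.*2.+1) := inord M.

Section dynamics.
Context {R : realType}.

(* x + (i - M) modulo N *)
Definition window_site (M N : nat) (x : 'I_N) (i : 'I_(M.*2.+1)) : 'I_N :=
  iter i (@ordS N) (iter M (@ord_pred N) x).

Definition window (M N : nat) (x : 'I_N) (eta : config N) : pattern M :=
  [ffun i => eta (window_site x i)].

Definition exchange (N : nat) (eta : config N) (x y : 'I_N) : config N :=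
  [ffun z => if z == x then eta y else if z == y then eta x else eta z].

Definition flip (N : nat) (eta : config N) (x : 'I_N) : config N :=
  [ffun z => if z == x then ~~ eta x else eta z].

Definition generator (M : nat) (c : pattern M -> R) (N : nat)
    (f : config N -> R) (eta : config N) : R :=
  N%:R ^+ 2 / 2 * \sum_(x < N) (f (exchange eta x (ordS x)) - f eta)
  + \sum_(x < N) c (window M x eta) * (f (flip eta x) - f eta).

(* The Markov semigroup (P_t f)(eta) = E_eta[f(eta_t)] = (exp(t L_N) f)(eta) of
   the chain with generator L_N, as a convergent exponential series. *)
Definition semigroup (M : nat) (c : pattern M -> R) (N : nat) (t : R)
    (f : config N -> R) (eta : config N) : R :=
  limn (series (fun n => exp_coeff t n * iter n (generator c (N:=N)) f eta)).

Definition invariant_measure (M : nat) (c : pattern M -> R) (N : nat)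
    (mu : probability (config N) R) : Prop :=
  forall (t : R) (f : config N -> R), 0 <= t ->
    (\int[mu]_eta (semigroup c t f eta) = \int[mu]_eta (f eta))%R.

(* Integral of a cylinder function against the Bernoulli product measure of
   density rho: only the (2M+1)-site marginal matters. *)
Definition bernoulli_mean (M : nat) (rho : R) (g : pattern M -> R) : R :=
  \sum_(xi : pattern M) (\prod_i (if xi i then rho else 1 - rho)) * g xi.

Definition birth (M : nat) (c : pattern M -> R) (rho : R) : R :=
  bernoulli_mean rho (fun xi => (1 - (xi (window_center M))%:R) * c xi).

Definition death (M : nat) (c : pattern M -> R) (rho : R) : R :=
  bernoulli_mean rho (fun xi => (xi (window_center M))%:R * c xi).

Definition reaction (M : nat) (c : pattern M -> R) (rho : R) : R :=
  birth c rho - death c rho.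

End dynamics.

(* T = R/Z = [0,1), with its Borel sigma-algebra, the trace of that of R. *)
Definition torus (R : realType) := {u : R | 0 <= u < 1}.

Section torus.
Context (R : realType).

Fact torus0_subproof : 0 <= (0 : R) < 1.
Proof. by rewrite lexx ltr01. Qed.

HB.instance Definition _ := Choice.on (torus R).
HB.instance Definition _ :=
  isPointed.Build (torus R) (exist _ 0 torus0_subproof).

Definition torus_val (u : torus R) : measurableTypeR R := \val u.

HB.instance Definition _ :=
  Measurable.copy (torus R) (g_sigma_algebra_preimageType torus_val).

Fact torus_site_subproof (N : nat) (x : 'I_N) :
  0 <= (x%:R / N%:R : R) < 1.
Proof.
have N0 : (0 < N)%N := leq_ltn_trans (leq0n x) (ltn_ord x).
by rewrite divr_ge0// ltr_pdivrMr ?ltr0n// mul1r ltr_nat ltn_ord.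
Qed.

Definition torus_site (N : nat) (x : 'I_N) : torus R :=
  exist _ (x%:R / N%:R) (torus_site_subproof x).

End torus.

(* M_+: the library's [giry T R] is the type of measures on T of total mass at
   most 1. Its sigma-algebra is generated by the evaluations pi |-> pi(A); on
   the compact metric space T it is the Borel one of the weak topology. *)
Notation subprob_torus R := (giry (torus R) R).

Section empirical.
Context {R : realType} {N : nat} (eta : config N).

Definition empirical_fun (A : set (torus R)) : \bar R :=
  ((N%:R^-1)%:E *
   \sum_(x < N) (eta x)%:R%:E * dirac (torus_site R x) A)%E.

Let site_measure (k : nat) : {measure set (torus R) -> \bar R} :=
  if insub k is Some x then
    mscale ((eta x)%:R)%:nng (dirac (torus_site R x))
  else mzero.

Let empirical_funE :
  empirical_fun = mscale ((N%:R^-1 : R)%:nng) (msum site_measure N).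
Proof.
apply/funext => A; rewrite /empirical_fun /mscale /msum /=; congr (_ * _)%E.
by apply: eq_bigr => x _; rewrite /site_measure valK.
Qed.

Let empirical0 : empirical_fun set0 = 0%E.
Proof. by rewrite empirical_funE measure0. Qed.

Let empirical_ge0 A : (0 <= empirical_fun A)%E.
Proof. by rewrite empirical_funE; exact: measure_ge0. Qed.

Let empirical_sigma_additive : semi_sigma_additive empirical_fun.
Proof. by rewrite empirical_funE; exact: measure_semi_sigma_additive. Qed.

HB.instance Definition _ := isMeasure.Build _ _ _ empirical_fun
  empirical0 empirical_ge0 empirical_sigma_additive.

Let empirical_setT : (empirical_fun [set: torus R] <= 1)%E.
Proof.
rewrite /empirical_fun.
under eq_bigr do rewrite diracT mule1.
rewrite sumEFin -EFinM lee_fin.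
have le_sum : \sum_(x < N) (eta x)%:R <= N%:R :> R.
  have -> : N%:R = \sum_(x < N) 1 :> R by rewrite sumr_const card_ord.
  by apply: ler_sum => x _; case: (eta x).
have [N0|N0] := eqVneq (N%:R : R) 0; first by rewrite N0 invr0 mul0r.
by rewrite mulrC ler_pdivrMr ?mul1r// lt_def N0 ler0n.
Qed.

HB.instance Definition _ :=
  Measure_isSubProbability.Build _ _ _ empirical_fun empirical_setT.

Definition empirical : subprob_torus R := empirical_fun.

End empirical.

Section stationary_profiles.
Context {R : realType}.

Definition pairing (pi0 : subprob_torus R) (G : torus R -> R) : R :=
  (\int[pi0]_u G u)%R.

Definition trig (k : nat) (u : torus R) : R :=
  if odd k then sin (2 * pi * (k./2)%:R * \val u)
  else cos (2 * pi * (k./2)%:R * \val u).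

(* All terms are nonnegative and at most 2^(1-k), so the sum exists in \bar R
   and is finite. *)
Definition dist (pi1 pi2 : subprob_torus R) : \bar R :=
  (\sum_(0 <= k <oo)
     ((2 ^+ k)^-1 * `|pairing pi1 (trig k) - pairing pi2 (trig k)|)%:E)%E.

(* Functions on R/Z are represented as 1-periodic functions on R. *)
Definition classical_solution (M : nat) (c : pattern M -> R) (rho : R -> R)
    : Prop :=
  [/\ periodic rho 1,
      (forall u, 0 <= rho u <= 1),
      (forall u, derivable rho u 1) /\ (forall u, derivable (derive1 rho) u 1),
      continuous (derive1n 2 rho) &
      forall u, 2^-1 * derive1n 2 rho u + reaction c (rho u) = 0].

Definition has_density (pi0 : subprob_torus R) (rho : R -> R) : Prop :=
  forall A : set (torus R), measurable A ->
    pi0 A = (\int[lebesgue_measure]_(u in (@torus_val R) @` A) (rho u)%:E)%E.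

Definition stationary_set (M : nat) (c : pattern M -> R)
    : set (subprob_torus R) :=
  [set pi0 | exists2 rho, classical_solution c rho & has_density pi0 rho].

(* The infimum is taken in \bar R, where inf of the empty set is +oo. *)
Definition dist_set (pi0 : subprob_torus R) (E : set (subprob_torus R))
    : \bar R :=
  ereal_inf [set dist pi0 pibar | pibar in E].

Definition empirical_law (N : nat) (mu : probability (config N) R)
    : set (subprob_torus R) -> \bar R :=
  pushforward mu (@empirical R N).

End stationary_profiles.

(* Main.v *)
Require Import Defs.
From HB Require Import structures.
From mathcomp Require Import all_boot all_order all_algebra all_fingroup.
From mathcomp Require Import all_classical all_reals all_analysis.
From mathcomp Require Import giry measurable_realfun ring lra zify.

Set Implicit Arguments.
Unset Strict Implicit.
Unset Printing Implicit Defensive.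

Import Order.TTheory GRing.Theory Num.Theory.
Import numFieldNormedType.Exports.

Local Open Scope classical_set_scope.
Local Open Scope ring_scope.

(** The stationary state is studied without the dynamics, through the sole identity
    that the mean of [generator c f] vanishes for every [f].

    Take for [f] the energy [sum_x (N^2/4) (phi(x+1) - phi(x))^2 - Phi(phi(x))] of
    the field [phi] obtained by averaging the configuration on boxes of size
    [l = N / q], where [Phi' = F]. It is a Lyapunov functional of the equation
    [rho_t = (1/2) rho'' + F(rho)]: if the drift of [phi] were exactly its residual
    [(N^2/2) Laplacian phi + F(phi)] and fluctuations were ignored, the generator
    applied to the energy would be minus the sum of the squares of the residual.
    There are two errors. The noise is negligible because the field is smooth
    ([generator_energy]). The closure error, between the averaged reaction term and
    [F(phi)], is controlled by local equilibrium ([local_equilibrium]). Hence the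
    mean of the squared residual per site is of order [1 / q] when [N] is large
    ([stationary_residual]).

    Local equilibrium comes from entropy production. The exchanges are accelerated
    by [N^2], so stationarity tested against the logarithm of the weight forces the
    state to be almost invariant under exchanges: the total variation costs of the
    [N] nearest neighbour exchanges have a bounded sum ([sum_tv_bond]), and
    exchanging sites at distance [l] costs order [l / N] on average. As [F(phi(x))]
    is the mean of the drift read at independent random sites near [x], while the
    averaged drift reads it in a random window near [x], transpositions match one
    with the other.

    A configuration with a small residual is close to a solution, by compactness
    ([almost_solution_close]): the discrete derivative of the field is
    Lipschitz up to the residual, and a limit along an ultrafilter of fields on finer
    and finer lattices with residuals tending to 0 is a classical solution. Closeness
    of the field to a solution gives closeness of the empirical measure in the
    distance [dist], up to the oscillation of the trigonometric functions at scale
    [3 l] ([dist_le]). Markov's inequality concludes. *)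

(** * Rotations, permutations and exchange costs *)

Section sites.
Context {N : nat}.
Implicit Types (x y : 'I_N) (i j k : nat).

Definition sh (x : 'I_N) (i : nat) : 'I_N := iter i (@ordS N) x.
Arguments sh : simpl never.

Lemma shS x i : sh x i.+1 = ordS (sh x i).
Proof. by []. Qed.

Lemma sh_ordS x i : sh (ordS x) i = ordS (sh x i).
Proof. by rewrite /sh -iterS iterSr. Qed.

Lemma shD x i j : sh (sh x i) j = sh x (i + j)%N.
Proof. by rewrite /sh addnC iterD. Qed.

Lemma sh_inj i : injective (fun x => sh x i).
Proof. by elim: i => [//|i IH] x y /= /ordS_inj /IH. Qed.

Lemma val_sh x i : sh x i = ((x + i) %% N)%N :> nat.
Proof.
elim: i => [|i IH]; first by rewrite addn0 modn_small.
by rewrite shS /= IH -addn1 modnDml addn1 addnS.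
Qed.

Lemma sh_inj2 x i j : (i < N)%N -> (j < N)%N -> sh x i = sh x j -> i = j.
Proof.
move=> iN jN /(congr1 val) /=; rewrite !val_sh => /eqP.
by rewrite eqn_modDl !modn_small // => /eqP.
Qed.

Lemma sum_sh (V : nmodType) i (f : 'I_N -> V) : \sum_x f (sh x i) = \sum_x f x.
Proof. by rewrite [RHS](reindex_inj (@sh_inj i)). Qed.

End sites.
Arguments sh : simpl never.

Section permutations.
Context {R : realType} {N : nat}.
Implicit Types (eta : config N) (s t : {perm 'I_N}) (f G : config N -> R).

Definition permute s eta : config N := [ffun z => eta (s z)].

Lemma permuteM s t eta : permute (s * t)%g eta = permute s (permute t eta).
Proof. by apply/ffunP => z; rewrite !ffunE permM. Qed.

Lemma permute1 eta : permute 1%g eta = eta.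
Proof. by apply/ffunP => z; rewrite !ffunE perm1. Qed.

Lemma permuteK s : cancel (permute s) (permute s^-1%g).
Proof. by move=> eta; rewrite -permuteM mulVg permute1. Qed.

Lemma permute_inj s : injective (permute s).
Proof. exact: can_inj (permuteK s). Qed.

Lemma exchangeE eta x y : exchange eta x y = permute (tperm x y) eta.
Proof.
apply/ffunP => z; rewrite !ffunE.
by case: tpermP => [->|->|/eqP/negbTE-> /eqP/negbTE->//];
  rewrite eqxx //; case: eqP => [->|].
Qed.

(** When [f] is a probability weight, twice the total variation distance between
    [f] and its image under [s]. *)
Definition tv f s : R := \sum_eta `|f (permute s eta) - f eta|.

Lemma tv1 f : tv f 1%g = 0.
Proof. by rewrite /tv big1 // => eta _; rewrite permute1 subrr normr0. Qed.

Lemma tv_ge0 f s : 0 <= tv f s.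
Proof. by rewrite sumr_ge0. Qed.

Lemma tvM f s t : tv f (s * t)%g <= tv f s + tv f t.
Proof.
rewrite /tv [X in X + _](reindex_inj (@permute_inj t)) -big_split /=.
by apply: ler_sum => eta _; rewrite permuteM ler_distD.
Qed.

(** A change of variables moves the permutation from [G] to [f]. *)
Lemma tv_dual f G (B : R) s : (forall eta, `|G eta| <= B) ->
  `|\sum_eta f eta * (G (permute s eta) - G eta)| <= B * tv f s.
Proof.
move=> GB; have -> : \sum_eta f eta * (G (permute s eta) - G eta) =
    \sum_eta (f eta - f (permute s eta)) * G (permute s eta).
  under eq_bigr do rewrite mulrBr; under [RHS]eq_bigr do rewrite mulrBl.
  rewrite !sumrB; congr (_ - _).
  by rewrite (reindex_inj (@permute_inj s)).
rewrite (le_trans (ler_norm_sum _ _ _)) // /tv mulr_sumr.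
apply: ler_sum => eta _; rewrite normrM mulrC distrC.
by rewrite ler_wpM2r.
Qed.

(** Exchanging two distant sites is a palindrome of nearest neighbour exchanges:
    carry one content along the way and bring the other one back. *)
Lemma tv_tperm_sh f x k :
  tv f (tperm x (sh x k)) <=
  2 * \sum_(j < k) tv f (tperm (sh x j) (ordS (sh x j))).
Proof.
elim: k => [|k IH]; first by rewrite big_ord0 mulr0 tperm1 tv1.
rewrite big_ord_recr /= mulrDr shS.
set S := \sum_(j < k) _ in IH *; set y := sh x k.
have b0 := tv_ge0 f (tperm y (ordS y)).
have S0 : 0 <= S by rewrite sumr_ge0 // => j _; exact: tv_ge0.
have [Ex|nx] := eqVneq (ordS y) x.
  by rewrite Ex tperm1 tv1 -Ex; lra.
have [xy|nxy] := eqVneq y x.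
  by rewrite xy in b0 *; lra.
have -> : tperm x (ordS y) =
    (tperm y (ordS y) * (tperm x y * tperm y (ordS y)))%g.
  have -> : tperm y (ordS y) = (tperm y (ordS y))^-1%g by rewrite tpermV.
  rewrite {2}tpermV -/(conjg _ _) tpermJ tpermL tpermD //.
have h1 := tvM f (tperm y (ordS y)) (tperm x y * tperm y (ordS y))%g.
have h2 := tvM f (tperm x y) (tperm y (ordS y)).
rewrite -/y in IH; lra.
Qed.

Lemma tv_tperm_window f x L i j : (i <= L)%N -> (j <= L)%N ->
  tv f (tperm (sh x i) (sh x j)) <=
  2 * \sum_(k < L) tv f (tperm (sh x k) (ordS (sh x k))).
Proof.
wlog ij : i j / (i <= j)%N => [W|] iL jL.
  by have [ij|/ltnW ij] := leqP i j; [|rewrite tpermC]; exact: W.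
rewrite -{1}(subnKC ij) -shD (le_trans (tv_tperm_sh _ _ _)) // ler_pM2l //.
under eq_bigr do rewrite shD.
rewrite -(big_mkord predT (fun k => tv f (tperm (sh x (i + k)%N) (ordS (sh x (i + k)%N))))).
rewrite -(big_mkord predT (fun k => tv f (tperm (sh x k) (ordS (sh x k))))).
rewrite (big_cat_nat (n := i) (p := L)) //= (big_cat_nat (n := j) (p := L)) //=.
have shift (F : nat -> R) :
    \sum_(i <= k < j) F k = \sum_(0 <= k < j - i) F (i + k)%N.
  by rewrite -{1}[i]add0n big_addn; apply: eq_bigr => k _; rewrite addnC.
rewrite [X in _ + (X + _)]shift.
rewrite [leRHS]addrCA lerDl addr_ge0 // sumr_ge0 // => *; exact: tv_ge0.
Qed.

(** Moving the points [a i] one after the other onto the points [b i] by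
    transpositions: earlier targets are never displaced because [b] is
    injective and the current position of [a k] differs from them. *)
Lemma transport f n (a b : 'I_n -> 'I_N) (S : pred 'I_N) (D : R) :
  injective a -> injective b -> (forall i, S (a i)) -> (forall i, S (b i)) ->
  (forall u v, S u -> S v -> tv f (tperm u v) <= D) ->
  exists2 s : {perm 'I_N}, forall i, s (a i) = b i & tv f s <= n%:R * D.
Proof.
move=> ainj binj aS bS SD.
suff build : forall k, (k <= n)%N -> exists s : {perm 'I_N},
    [/\ forall i : 'I_n, (i < k)%N -> s (a i) = b i,
        forall u, S u -> S (s u) & tv f s <= k%:R * D].
  by have [s [sab _ sD]] := build n (leqnn n); exists s => // i; exact: sab.
elim=> [|k IH] kn.
  by exists 1%g; split=> [//|u|]; rewrite ?perm1 // tv1 mul0r.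
have [s [sab sS sD]] := IH (ltnW kn); pose k' := Ordinal kn.
exists (s * tperm (s (a k')) (b k'))%g; split=> [i|u Su|].
- rewrite ltnS leq_eqVlt => /orP[/eqP ik|ik].
    by have -> : i = k' by [apply: val_inj]; rewrite permM tpermL.
  rewrite permM (sab i) // tpermD //.
  + rewrite -(sab i ik); apply/eqP => /perm_inj /ainj /(congr1 val) /= E.
    by rewrite E ltnn in ik.
  + by apply/eqP => /binj /(congr1 val) /= E; rewrite E ltnn in ik.
- by rewrite permM; case: tpermP => _ //; auto.
- rewrite (le_trans (tvM _ _ _)) // -[k.+1]addn1 natrD mulrDl mul1r lerD //.
  by apply: SD => //; apply: sS.
Qed.

End permutations.

(** * Entropy production *)

Section entropy.
Context {R : realType} {M : nat} {c : pattern M -> R} {N : nat}.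
Context {m : config N -> R} {C : R}.
Hypothesis c_ge0 : forall xi, 0 <= c xi.
Hypothesis c_le : forall xi, c xi <= C.
Hypothesis m_ge0 : forall eta, 0 <= m eta.
Hypothesis m_sum : \sum_eta m eta = 1.
Hypothesis stat : forall f, \sum_eta m eta * generator c f eta = 0.

Lemma flip_inj (x : 'I_N) : injective (fun eta : config N => flip eta x).
Proof.
have K : cancel (fun eta : config N => flip eta x) (fun eta => flip eta x).
  move=> eta; apply/ffunP => z; rewrite !ffunE eqxx negbK.
  by case: eqP => [->|].
exact: can_inj K.
Qed.

Lemma ln_le_subr1 (x : R) : 0 < x -> ln x <= x - 1.
Proof.
move=> x0; have := @expR_ge1Dx R (ln x).
by rewrite lnK ?posrE // lerBrDl.
Qed.

Let bond (x : 'I_N) := tperm x (ordS x).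
(** Added to the weight to keep the logarithm finite; this value keeps the total
   mass of [s ^+ 2] equal to 2. *)
Let e : R := (#|{: config N}|%:R)^-1.
Let s eta := Num.sqrt (m eta + e).

Let e_gt0 : 0 < e.
Proof.
rewrite invr_gt0 ltr0n; apply/card_gt0P; by exists [ffun=> false].
Qed.

Let me_gt0 eta : 0 < m eta + e.
Proof. by rewrite ltr_wpDl. Qed.

Let s_gt0 eta : 0 < s eta. Proof. by rewrite sqrtr_gt0. Qed.

Let sE eta : m eta + e = s eta ^+ 2.
Proof. by rewrite sqr_sqrtr // ltW. Qed.

Let sum_s2 : \sum_eta s eta ^+ 2 = 2.
Proof.
under eq_bigr do rewrite -sE; rewrite big_split /= m_sum sumr_const.
rewrite -[_ *+ #|_|]mulr_natr mulVf // lt0r_neq0 // -invr_gt0; exact: e_gt0.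
Qed.

(** Twice [ln t <= t - 1], at [t = b / a] and at [t = a / b]. *)
Let sqr_ln (a b : R) : 0 < a -> 0 < b ->
  (a ^+ 2 - b ^+ 2) * (ln (b ^+ 2) - ln (a ^+ 2)) <= - 2 * (b - a) ^+ 2.
Proof.
move=> a0 b0; rewrite !lnXn //.
have h1 := ln_le_subr1 (divr_gt0 b0 a0).
have h2 := ln_le_subr1 (divr_gt0 a0 b0).
rewrite ln_div ?posrE // in h1; rewrite ln_div ?posrE // in h2.
have k1 : a ^+ 2 * (ln b - ln a) <= a * (b - a).
  rewrite (le_trans (ler_wpM2l (exprn_ge0 _ (ltW a0)) h1)) // le_eqVlt.
  by apply/orP; left; apply/eqP; field; rewrite gt_eqF.
have k2 : b ^+ 2 * (ln a - ln b) <= b * (a - b).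
  rewrite (le_trans (ler_wpM2l (exprn_ge0 _ (ltW b0)) h2)) // le_eqVlt.
  by apply/orP; left; apply/eqP; field; rewrite gt_eqF.
lra.
Qed.

Let exchange_ln x :
  \sum_eta m eta * (ln (m (permute (bond x) eta) + e) - ln (m eta + e)) <=
  - \sum_eta (s (permute (bond x) eta) - s eta) ^+ 2.
Proof.
set L := (X in X <= _).
have LE : L = \sum_eta m (permute (bond x) eta) *
    (ln (m eta + e) - ln (m (permute (bond x) eta) + e)).
  rewrite /L (reindex_inj (@permute_inj _ (bond x))) /=.
  apply: eq_bigr => eta _; congr (_ * (ln (m _ + _) - _)).
  by rewrite -permuteM tperm2 permute1.
have : L + L <= \sum_eta - 2 * (s (permute (bond x) eta) - s eta) ^+ 2.
  rewrite {2}LE /L -big_split /=; apply: ler_sum => eta _.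
  rewrite (le_trans _ (sqr_ln (s_gt0 _) (s_gt0 _))) // -!sE.
  by rewrite le_eqVlt; apply/orP; left; apply/eqP; ring.
rewrite -mulr_sumr => h; lra.
Qed.

Let flip_ln x :
  \sum_eta m eta * (c (window M x eta) *
      (ln (m (flip eta x) + e) - ln (m eta + e))) <= C.
Proof.
apply: (@le_trans _ _ (\sum_eta C * m (flip eta x))); last first.
  have flip_sum : \sum_eta m (flip eta x) = \sum_eta m eta.
    by rewrite [RHS](reindex_inj (@flip_inj x)).
  by rewrite -mulr_sumr flip_sum m_sum mulr1.
apply: ler_sum => eta _; rewrite mulrCA.
apply: (@le_trans _ _ (c (window M x eta) * m (flip eta x))); last first.
  exact: ler_wpM2r.
apply: ler_wpM2l => //; rewrite -ln_div ?posrE //.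
have h := ln_le_subr1 (divr_gt0 (me_gt0 (flip eta x)) (me_gt0 eta)).
rewrite (le_trans (ler_wpM2l (m_ge0 _) h)) //.
have -> : (m (flip eta x) + e) / (m eta + e) - 1 =
    (m (flip eta x) - m eta) / (m eta + e).
  by field; rewrite gt_eqF.
rewrite mulrA ler_pdivrMr //.
have := m_ge0 eta; have := m_ge0 (flip eta x); have := e_gt0; nra.
Qed.

Let dirichlet : (0 < N)%N ->
  \sum_x \sum_eta (s (permute (bond x) eta) - s eta) ^+ 2 <= 2 * C / N%:R.
Proof.
move=> N0; set D := (X in X <= _).
have N1 : 0 < N%:R :> R by rewrite ltr0n.
have := stat (fun eta => ln (m eta + e)).
rewrite /generator; under eq_bigr do rewrite mulrDr.
rewrite big_split /=.
under eq_bigr => eta _.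
  rewrite mulrCA mulr_sumr.
  under eq_bigr => x _ do rewrite exchangeE -/(bond x).
  over.
rewrite -mulr_sumr exchange_big /=.
under [X in _ + X]eq_bigr do rewrite mulr_sumr.
rewrite [X in _ + X]exchange_big /=.
set A := \sum_(i < N) _; set B := \sum_(i < N) _ => AB.
have AD : A <= - D by rewrite /A /D -sumrN; apply: ler_sum => x _.
have BC : B <= C * N%:R.
  apply: (@le_trans _ _ (\sum_(x < N) C)); first exact: ler_sum.
  by rewrite sumr_const card_ord mulr_natr.
rewrite ler_pdivlMr //.
have : N%:R * (N%:R / 2 * A) + B = 0 by rewrite -AB; congr (_ + _); field.
move=> AB'.
have : N%:R * (N%:R / 2 * A + C) >= 0 by nra.
rewrite pmulr_rge0 //; nra.
Qed.

(** The stationary state is nearly invariant under exchanges. Testing stationarity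
    against the logarithm of the weight bounds the Dirichlet form of its square
    root: the Glauber part produces entropy of order [N], against a prefactor
    [N ^+ 2] on the exchange part. The sum of the squared Hellinger distances over
    the bonds is thus of order [1 / N], and by the arithmetic-geometric inequality
    each of the [N] bonds contributes order [1 / N] to the sum of the L^1
    distances. *)
Lemma sum_tv_bond : (0 < N)%N -> \sum_x tv m (tperm x (ordS x)) <= C + 4.
Proof.
move=> N0; have N1 : 0 < N%:R :> R by rewrite ltr0n.
have H x : tv m (tperm x (ordS x)) <= N%:R / 2 *
    (\sum_eta (s (permute (bond x) eta) - s eta) ^+ 2) + 4 / N%:R.
  have -> : 4 / N%:R = (2 * N%:R)^-1 *
      \sum_eta 2 * (s (permute (bond x) eta) ^+ 2 + s eta ^+ 2) :> R.
    rewrite -mulr_sumr big_split /=.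
    have -> : \sum_eta s (permute (bond x) eta) ^+ 2 = 2.
      by rewrite -sum_s2 [RHS](reindex_inj (@permute_inj _ (bond x))).
    by rewrite sum_s2; field; rewrite gt_eqF.
  rewrite !mulr_sumr -big_split /=; apply: ler_sum => eta _.
  have -> : m (permute (bond x) eta) - m eta =
      (s (permute (bond x) eta) - s eta) * (s (permute (bond x) eta) + s eta).
    by rewrite -subr_sqr -!sE; ring.
  set u := s _; set v := s _; rewrite normrM.
  have -> : `|u + v| = u + v by rewrite ger0_norm //; apply: addr_ge0; apply: ltW; exact: s_gt0.
  have -> : N%:R / 2 * (u - v) ^+ 2 = N%:R / 2 * `|u - v| ^+ 2.
    by rewrite real_normK // num_real.
  set d := `|u - v|.
  apply: (@le_trans _ _ (N%:R / 2 * d ^+ 2 + (2 * N%:R)^-1 * (u + v) ^+ 2)).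
    rewrite -subr_ge0 (_ : _ - _ = (N%:R * d - (u + v)) ^+ 2 / (2 * N%:R)).
      by rewrite divr_ge0 ?sqr_ge0 // mulr_ge0 ?ltW.
    by field; rewrite gt_eqF.
  rewrite lerD2l; apply: ler_wpM2l; first by rewrite invr_ge0 mulr_ge0 // ltW.
  have := sqr_ge0 (u - v); lra.
apply: (@le_trans _ _ (\sum_x (N%:R / 2 *
    (\sum_eta (s (permute (bond x) eta) - s eta) ^+ 2) + 4 / N%:R))).
  by apply: ler_sum => x _; exact: H.
rewrite big_split /= -mulr_sumr sumr_const card_ord.
have -> : (4 / N%:R) *+ N = 4 :> R by rewrite -mulr_natr divfK // gt_eqF.
rewrite lerD2r. have := dirichlet N0. rewrite ler_pdivlMr // => h. lra.
Qed.

End entropy.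

(** * Box averages *)

Section box.
Context {R : realType} {N : nat}.
Implicit Types (v w : 'I_N -> R) (x y z : 'I_N).

Definition box (l : nat) v x : R := l%:R^-1 * \sum_(i < l) v (sh x i).

(** Three averages are needed: an exchange of neighbours then changes the gradient
    of the averaged configuration by order [l ^- 3]. With two, the change would be
    of order [l ^- 2] at a few sites, and its second order effect on the energy of
    the same order as the dissipation. *)
Definition box3 (l : nat) v : 'I_N -> R := box l (box l (box l v)).

Definition fwd v x : R := v (ordS x) - v x.

Variable l : nat.
Hypothesis l_gt0 : (0 < l)%N.

Let l0 : 0 < l%:R :> R. Proof. by rewrite ltr0n. Qed.

Lemma eq_box v w : v =1 w -> box l v =1 box l w.
Proof. by move=> vw x; rewrite /box; congr (_ * _); apply: eq_bigr. Qed.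

Lemma eq_box3 v w : v =1 w -> box3 l v =1 box3 l w.
Proof. by move=> vw; do 3!apply: eq_box. Qed.

Lemma box_sum (I : finType) (a : I -> R) (f : I -> 'I_N -> R) x :
  box l (fun y => \sum_i a i * f i y) x = \sum_i a i * box l (f i) x.
Proof.
rewrite /box exchange_big /= mulr_sumr; apply: eq_bigr => i _.
by rewrite -mulr_sumr mulrCA.
Qed.

Lemma box3_sum (I : finType) (a : I -> R) (f : I -> 'I_N -> R) x :
  box3 l (fun y => \sum_i a i * f i y) x = \sum_i a i * box3 l (f i) x.
Proof.
rewrite /box3 -box_sum; apply: eq_box => y.
by rewrite -box_sum; apply: eq_box => z; rewrite box_sum.
Qed.

Lemma box3B v w x : box3 l (fun y => v y - w y) x = box3 l v x - box3 l w x.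
Proof.
have -> : box3 l v x - box3 l w x =
    \sum_(b : bool) (-1) ^+ b * box3 l (if b then w else v) x.
  by rewrite big_bool /= expr1 expr0; ring.
rewrite -box3_sum; apply: eq_box3 => y.
by rewrite big_bool /= expr1 expr0; ring.
Qed.

Lemma box_cst (a : R) x : box l (fun=> a) x = a.
Proof. by rewrite /box sumr_const card_ord -[a *+ _]mulr_natl mulKf // gt_eqF. Qed.

Lemma box3_cst (a : R) x : box3 l (fun=> a) x = a.
Proof.
rewrite -[RHS](box_cst a x); apply: eq_box => y.
by rewrite -[RHS](box_cst a y); apply: eq_box => z; rewrite box_cst.
Qed.

Lemma box_norm v (B : R) : (forall x, `|v x| <= B) ->
  forall x, `|box l v x| <= B.
Proof.
move=> vB x; rewrite /box normrM gtr0_norm ?invr_gt0 //.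
rewrite ler_pdivrMl // (le_trans (ler_norm_sum _ _ _)) //.
have -> : l%:R * B = \sum_(i < l) B by rewrite sumr_const card_ord mulr_natl.
exact: ler_sum.
Qed.

Lemma box_ge0 v : (forall x, 0 <= v x) -> forall x, 0 <= box l v x.
Proof. by move=> v0 x; rewrite mulr_ge0 ?invr_ge0 ?sumr_ge0 // ltW. Qed.

Lemma box_fwd v x : fwd (box l v) x = l%:R^-1 * (v (sh x l) - v x).
Proof.
rewrite /fwd /box -mulrBr; congr (_ * _).
under eq_bigr do rewrite sh_ordS -shS.
rewrite -(big_mkord predT (fun i => v (sh x i.+1))).
rewrite -(big_mkord predT (fun i => v (sh x i))) -sumrB.
by rewrite telescope_sumr.
Qed.

Lemma fwd_box v x : box l (fwd v) x = fwd (box l v) x.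
Proof.
rewrite /box /fwd -mulrBr -sumrB; congr (_ * _).
by apply: eq_bigr => i _; rewrite sh_ordS.
Qed.

Lemma box_fwd_norm v (B : R) : (forall x, `|v x| <= B) ->
  forall x, `|fwd (box l v) x| <= 2 / l%:R * B.
Proof.
move=> vB x; rewrite box_fwd normrM gtr0_norm ?invr_gt0 //.
rewrite [2 / _]mulrC -mulrA; apply: ler_wpM2l; first by rewrite invr_ge0 ltW.
have := ler_normB (v (sh x l)) (v x); have := vB x; have := vB (sh x l); lra.
Qed.

Hypothesis lN : (l <= N)%N.

Definition point z : 'I_N -> R := fun y => (y == z)%:R.

Lemma box_point z x : `|box l (point z) x| <= l%:R^-1.
Proof.
rewrite /box normrM gtr0_norm ?invr_gt0 //.
apply: ler_piMr; first by rewrite invr_ge0 ltW.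
rewrite ger0_norm ?sumr_ge0 // /point.
have [[i /= /eqP Ei]|no] :=
    pselect (exists i : 'I_l, sh x i == z); last first.
  rewrite big1 // => i _; case: eqP => // E; case: no; exists i; exact/eqP.
rewrite (bigD1 i) //= Ei eqxx big1 ?addr0 // => j ji.
case: eqP => // Ej; case/eqP: ji; apply: val_inj.
by apply: (@sh_inj2 N x); rewrite ?Ei ?Ej // (leq_trans (ltn_ord _)).
Qed.

Lemma fwd_box3_norm v (B : R) : (forall x, `|box l v x| <= B) ->
  forall x, `|fwd (box3 l v) x| <= 2 / l%:R * B.
Proof. by move=> vB; apply: box_fwd_norm; apply: box_norm. Qed.

Lemma box3_fwd_norm v (B : R) : (forall x, `|box l v x| <= B) ->
  forall x, `|box3 l (fwd v) x| <= 2 / l%:R * B.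
Proof.
move=> vB x; have -> : box3 l (fwd v) x = box3 l v (ordS x) - box3 l v x.
  rewrite -/(fwd _ x) -fwd_box; apply: eq_box => y.
  by rewrite -fwd_box; apply: eq_box => z; rewrite fwd_box.
exact: fwd_box3_norm.
Qed.

Lemma fwd_box3_fwd_norm v (B : R) : (forall x, `|box l v x| <= B) ->
  forall x, `|fwd (box3 l (fwd v)) x| <= 2 / l%:R * (2 / l%:R * B).
Proof.
move=> vB x; apply: box_fwd_norm => y.
rewrite (_ : box l _ y = fwd (box l (box l v)) y); first exact: box_fwd_norm.
by rewrite -fwd_box; apply: eq_box => z; rewrite fwd_box.
Qed.

(** The law of [x + i + j + k] for independent [i], [j], [k] uniform on
    [0, l). *)
Definition kernel x z : R := box3 l (point z) x.

Lemma kernelE v x : box3 l v x = \sum_z kernel x z * v z.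
Proof.
under eq_bigr do rewrite mulrC.
rewrite -box3_sum; apply: eq_box3 => y.
rewrite (bigD1 y) //= /point eqxx mulr1 big1 ?addr0 // => z /negbTE zy.
by rewrite eq_sym zy mulr0.
Qed.

Lemma kernel_ge0 x z : 0 <= kernel x z.
Proof. by do 3!apply: box_ge0 => {}x; rewrite /point. Qed.

Lemma kernel_sum x : \sum_z kernel x z = 1.
Proof.
by rewrite -[RHS](box3_cst 1 x) kernelE; apply: eq_bigr => z _; rewrite mulr1.
Qed.

Lemma kernel_le x z : kernel x z <= l%:R^-1.
Proof.
apply: (le_trans (ler_norm _)).
by apply: box_norm => {}x; apply: box_norm => {}x; exact: box_point.
Qed.

Let box_neq0 v x : box l v x != 0 -> exists2 i, (i < l)%N & v (sh x i) != 0.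
Proof.
move=> vx; apply: contrapT => no; case/eqP: vx.
rewrite /box big1 ?mulr0 // => i _; apply/eqP; apply: contrapT => /negP vi.
by apply: no; exists i.
Qed.

Lemma kernel_supp x z : kernel x z != 0 -> exists2 j, (j < 3 * l)%N & z = sh x j.
Proof.
move=> /box_neq0[i il] /box_neq0[j jl] /box_neq0[k kl].
rewrite /point; case: (_ =P z) => [<- _|_]; last by rewrite eqxx.
by rewrite !shD; eexists; last reflexivity; lia.
Qed.

End box.

(** * Local equilibrium *)

Section product_sampling.
Context {R : realType} {N n : nat} {J : 'I_N -> R}.
Hypothesis J_ge0 : forall z, 0 <= J z.
Hypothesis J_sum : \sum_z J z = 1.
Implicit Types (z : {ffun 'I_n -> 'I_N}).

(** The mean of [f] at [n] independent points of law [J]. *)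
Definition sample (f : {ffun 'I_n -> 'I_N} -> R) : R :=
  \sum_(z : {ffun 'I_n -> 'I_N}) (\prod_i J (z i)) * f z.

Lemma sample_prod (h : 'I_n -> 'I_N -> R) :
  sample (fun z => \prod_i h i (z i)) = \prod_i \sum_y J y * h i y.
Proof.
by rewrite bigA_distr_bigA; apply: eq_bigr => z _; rewrite -big_split.
Qed.

Lemma sample_cst (a : R) : sample (fun=> a) = a.
Proof.
rewrite /sample -mulr_suml -(bigA_distr_bigA (fun (_ : 'I_n) y => J y)) /=.
by rewrite big1 ?mul1r.
Qed.

Lemma sample_marginal (i : 'I_n) (h : 'I_N -> R) :
  sample (fun z => h (z i)) = \sum_y J y * h y.
Proof.
transitivity (sample (fun z => \prod_j (if j == i then h else fun=> 1) (z j))).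
  apply: eq_bigr => z _; congr (_ * _).
  by rewrite (bigD1 i) //= eqxx big1 ?mulr1 // => j /negbTE ->.
rewrite (sample_prod (fun j => if j == i then h else fun=> 1)).
rewrite (bigD1 i) //= eqxx [X in _ * X]big1 ?mulr1 // => j /negbTE ->.
by under eq_bigr do rewrite mulr1.
Qed.

Lemma le_sample (f g : {ffun 'I_n -> 'I_N} -> R) :
  (forall z, (forall i, J (z i) != 0) -> f z <= g z) -> sample f <= sample g.
Proof.
move=> fg; apply: ler_sum => z _.
have [/forallP zJ|] := boolP [forall i, J (z i) != 0].
  by rewrite ler_wpM2l ?prodr_ge0 //; exact: fg.
rewrite negb_forall => /existsP[i]; rewrite negbK => /eqP zi.
by rewrite (bigD1 i) //= zi !mul0r.
Qed.

Lemma sampleD f g : sample (fun z => f z + g z) = sample f + sample g.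
Proof. by rewrite /sample -big_split; apply: eq_bigr => z _; rewrite mulrDr. Qed.

Lemma sample_sum (I : finType) (f : I -> {ffun 'I_n -> 'I_N} -> R) :
  sample (fun z => \sum_i f i z) = \sum_i sample (f i).
Proof.
by rewrite /sample exchange_big; apply: eq_bigr => z _; rewrite mulr_sumr.
Qed.

Lemma sampleZ (a : R) f : sample (fun z => a * f z) = a * sample f.
Proof. by rewrite /sample mulr_sumr; apply: eq_bigr => z _; rewrite mulrCA. Qed.

Lemma sample_norm f : `|sample f| <= sample (fun z => `|f z|).
Proof.
rewrite (le_trans (ler_norm_sum _ _ _)) //; apply: ler_sum => z _.
by rewrite normrM ger0_norm // prodr_ge0.
Qed.

(** A union bound over the pairs of sample points. *)
Lemma sample_collision (b : R) : (forall y, J y <= b) ->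
  sample (fun z => (~~ injectiveb z)%:R) <= n%:R ^+ 2 * b.
Proof.
move=> Jb; have b0 (i : 'I_n) (y : 'I_N) : 0 <= b by exact: le_trans (Jb y).
apply: (@le_trans _ _ (sample (fun z => \sum_(p : 'I_n * 'I_n)
    ((p.1 != p.2) && (z p.1 == z p.2))%:R))).
  apply: le_sample => z _; have [_|/injectivePn] := boolP (injectiveb z).
    exact: sumr_ge0.
  case=> i [j ij zij]; rewrite (bigD1 (i, j)) //= ij zij eqxx lerDl.
  exact: sumr_ge0.
rewrite sample_sum.
have -> : n%:R ^+ 2 * b = \sum_(p : 'I_n * 'I_n) b.
  by rewrite sumr_const card_prod card_ord -[RHS]mulr_natl natrM expr2.
apply: ler_sum => -[i j] _ /=; have [->|ij] := eqVneq i j.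
  rewrite /sample big1 => [|z _]; last by rewrite eqxx mulr0.
  have [N0|] := posnP N; last by move=> ?; apply: (b0 i (Ordinal _)); eassumption.
  have : \sum_z J z = 0.
    by rewrite big1 // => -[k kN]; exfalso; rewrite N0 in kN.
  by rewrite J_sum => /eqP; rewrite oner_eq0.
have -> : sample (fun z => (true && (z i == z j))%:R) =
    \sum_s sample (fun z => \prod_k
      (if (k == i) || (k == j) then (z k == s)%:R else 1)).
  rewrite -sample_sum; apply: eq_bigr => z _; congr (_ * _).
  rewrite (bigD1 (z i)) //= (bigD1 i) //= !eqxx (bigD1 j) /=; last by rewrite eq_sym.
  rewrite eqxx orbT eq_sym big1 => [|k /andP[/negbTE-> /negbTE->]//].
  rewrite mulr1 mul1r big1 ?addr0 // => s /negbTE si.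
  by rewrite (bigD1 i) //= !eqxx [z i == s]eq_sym si mul0r.
under eq_bigr => s _.
  rewrite (sample_prod (fun k y => if (k == i) || (k == j) then (y == s)%:R else 1)).
  rewrite (bigD1 i) //= eqxx (bigD1 j) /=; last by rewrite eq_sym.
  rewrite eqxx orbT [X in _ * (_ * X)]big1 => [|k /andP[/negbTE-> /negbTE->]]; last first.
    by under eq_bigr do rewrite mulr1.
  have -> : \sum_y J y * (y == s)%:R = J s.
    rewrite (bigD1 s) //= eqxx mulr1 big1 ?addr0 // => y /negbTE ->.
    by rewrite mulr0.
  rewrite mulr1; over.
rewrite -[leRHS]mul1r -J_sum mulr_suml; apply: ler_sum => s _.
exact: ler_wpM2l.
Qed.

End product_sampling.

Section bernoulli_sampling.
Context {R : realType} {M N : nat} {J : 'I_N -> R} {g : pattern M -> R}.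
Hypothesis J_sum : \sum_z J z = 1.

(** The content of a random site of law [J] is a Bernoulli variable, whose mean is
    the average of [eta]; independent sites give the product measure. *)
Lemma bernoulli_mean_sample (eta : config N) :
  bernoulli_mean (\sum_z J z * (eta z)%:R) g =
  sample (fun z : {ffun 'I_(M.*2.+1) -> 'I_N} => g [ffun i => eta (z i)]) (J:=J).
Proof.
have E (b : bool) : (if b then \sum_z J z * (eta z)%:R
    else 1 - \sum_z J z * (eta z)%:R) = \sum_z J z * (eta z == b)%:R.
  case: b; first by apply: eq_bigr => z _; rewrite eqb_id.
  transitivity (\sum_z J z - \sum_z J z * (eta z)%:R); first by rewrite J_sum.
  rewrite -sumrB; apply: eq_bigr => z _.
  by case: (eta z); rewrite /= ?mulr1n ?mulr0n ?mulr1 ?mulr0 ?subr0 ?subrr.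
rewrite /bernoulli_mean.
under eq_bigr => xi _ do under eq_bigr => i _ do rewrite E.
under eq_bigr => xi _ do
  rewrite (bigA_distr_bigA (fun i y => J y * (eta y == xi i)%:R)) mulr_suml.
rewrite exchange_big /=; apply: eq_bigr => z _.
rewrite (bigD1 [ffun i => eta (z i)]) //= [X in _ + X]big1 => [|xi].
  rewrite addr0; congr (_ * _); apply: eq_bigr => i _.
  by rewrite ffunE eqxx mulr1.
move=> /eqP ne; have [i /eqP ni] : exists i, eta (z i) <> xi i.
  apply: contrapT => no; apply: ne; apply/ffunP => i; rewrite ffunE.
  by apply: contrapT => n; apply: no; exists i => E'; apply: n.
by rewrite (bigD1 i) //= (negbTE ni) !mulr0 !mul0r.
Qed.

End bernoulli_sampling.

Section window_geometry.
Context {M N : nat}.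
Implicit Types (x y : 'I_N) (i : 'I_(M.*2.+1)).

Definition window_start x : 'I_N := iter M (@ord_pred N) x.

Lemma sh_window_start x : sh (window_start x) M = x.
Proof.
rewrite /window_start; elim: M => [//|k IH].
by rewrite iterS shS -sh_ordS ord_predK.
Qed.

Lemma window_startS x j : window_start (sh x j) = sh (window_start x) j.
Proof.
by apply: (@sh_inj N M); rewrite sh_window_start shD addnC -shD sh_window_start.
Qed.

Lemma window_siteE x i : window_site x i = sh (window_start x) i.
Proof. by []. Qed.

Lemma window_start_inj : injective (window_start).
Proof. by move=> x y E; rewrite -(sh_window_start x) E sh_window_start. Qed.

Lemma window_site_inj1 i : injective (fun x => window_site x i).
Proof. by move=> x y; rewrite !window_siteE => /sh_inj /window_start_inj. Qed.

Lemma window_site_inj x : (M.*2 < N)%N -> injective (fun i => window_site x i).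
Proof.
move=> MN i j; rewrite !window_siteE => /sh_inj2 E; apply: val_inj; apply: E.
  by rewrite (leq_trans (ltn_ord i)).
by rewrite (leq_trans (ltn_ord j)).
Qed.

Lemma window_permute (s : {perm 'I_N}) (eta : config N) x :
  window M x (permute s eta) = [ffun i => eta (s (window_site x i))].
Proof. by apply/ffunP => i; rewrite !ffunE. Qed.

End window_geometry.

Section local_equilibrium.
Context {R : realType} {M N l : nat} {g : pattern M -> R} {B : R}.
Context {m : config N -> R} {C : R}.
Hypothesis l_gt0 : (0 < l)%N.
Hypothesis lN : (l <= N)%N.
Hypothesis MN : (M.*2 < N)%N.
Hypothesis g_le : forall xi, `|g xi| <= B.
Hypothesis m_ge0 : forall eta, 0 <= m eta.
Hypothesis m_sum : \sum_eta m eta = 1.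
Hypothesis m_tv : \sum_x tv m (tperm x (ordS x)) <= C.

Definition field (eta : config N) : 'I_N -> R :=
  box3 l (fun z => (eta z)%:R).

(** The error made in replacing the averaged drift by a function of the averaged
    configuration. *)
Definition closure_error (eta : config N) (x : 'I_N) : R :=
  bernoulli_mean (field eta x) g - box3 l (fun y => g (window M y eta)) x.

Let n := M.*2.+1.
Let J (x : 'I_N) := kernel (R:=R) l x.
Let readings (eta : config N) (z : {ffun 'I_n -> 'I_N}) : pattern M :=
  [ffun i => eta (z i)].
Let Jsum x := @kernel_sum R N l l_gt0 x.
Let Jge0 x := @kernel_ge0 R N l x.
Let Jle x := @kernel_le R N l l_gt0 lN x.

Let Javg x (a : R) : a = \sum_y J x y * a.
Proof. by rewrite -mulr_suml Jsum mul1r. Qed.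

Let mavg (a : R) : a = \sum_eta m eta * a.
Proof. by rewrite -mulr_suml m_sum mul1r. Qed.

Let B_ge0 : 0 <= B.
Proof. exact: le_trans (g_le [ffun=> false]). Qed.

Lemma closure_errorE eta x : closure_error eta x =
  sample (fun z => \sum_y J x y * (g (readings eta z) - g (window M y eta)))
    (J := J x).
Proof.
rewrite /closure_error /field !kernelE // bernoulli_mean_sample //.
have -> : \sum_y J x y * g (window M y eta) =
    sample (n:=n) (fun=> \sum_y J x y * g (window M y eta)) (J := J x).
  by rewrite sample_cst.
rewrite /sample -sumrB; apply: eq_bigr => z _; rewrite -mulrBr.
congr (_ * _); under [RHS]eq_bigr do rewrite mulrBr.
by rewrite sumrB -mulr_suml Jsum mul1r.
Qed.

Let g_diff xi xi' : `|g xi - g xi'| <= 2 * B.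
Proof.
by have := ler_normB (g xi) (g xi'); have := g_le xi; have := g_le xi'; lra.
Qed.

Lemma closure_error_le eta x : `|closure_error eta x| <= 2 * B.
Proof.
rewrite closure_errorE (le_trans (sample_norm (Jge0 x) _)) //.
rewrite -[leRHS](@sample_cst _ _ n _ (Jsum x)).
apply: (le_sample (Jge0 x)) => z _.
rewrite (le_trans (ler_norm_sum _ _ _)) // [leRHS](Javg x).
apply: ler_sum => y _; rewrite normrM ger0_norm ?Jge0 //.
apply: ler_wpM2l; [exact: Jge0|exact: g_diff].
Qed.

(** A transposition is visible in a pattern read at the sites [w] only if one of
    these sites is moved. *)
Let g_tperm eta (a b : 'I_N) (w : 'I_n -> 'I_N) :
  `|g [ffun i => permute (tperm a b) eta (w i)] - g [ffun i => eta (w i)]|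
  <= \sum_i 2 * B * ((w i == a)%:R + (w i == b)%:R).
Proof.
have t_ge0 i : 0 <= 2 * B * ((w i == a)%:R + (w i == b)%:R) by rewrite !mulr_ge0.
have [[i]|no] := pselect (exists i, (w i == a) || (w i == b)).
  move=> wi; rewrite (le_trans (g_diff _ _)) // (bigD1 i) //=.
  rewrite (le_trans (y := 2 * B * ((w i == a)%:R + (w i == b)%:R))) //.
    rewrite ler_peMr ?mulr_ge0 //.
    by case/orP: wi => ->; rewrite ?lerDl ?lerDr.
  by rewrite lerDl sumr_ge0.
have -> : [ffun i => permute (tperm a b) eta (w i)] = [ffun i => eta (w i)].
  apply/ffunP => i; rewrite !ffunE tpermD //; apply/eqP => E; apply: no;
    by exists i; rewrite E eqxx ?orbT.
by rewrite subrr normr0 sumr_ge0.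
Qed.

Lemma closure_error_tperm eta x a b :
  `|closure_error (permute (tperm a b) eta) x - closure_error eta x|
  <= 8 * B * n%:R / l%:R.
Proof.
set eta' := permute _ _.
have sampleB (f h : {ffun 'I_n -> 'I_N} -> R) :
    sample f (J := J x) - sample h (J := J x) = sample (fun z => f z - h z) (J := J x).
  by rewrite /sample -sumrB; apply: eq_bigr => z _; rewrite mulrBr.
rewrite /closure_error /field !kernelE // !bernoulli_mean_sample //.
set p1 := sample _; set p2 := \sum_z _; set q1 := sample _; set q2 := \sum_z _.
have h1 : `|p1 - q1| <= 4 * B * n%:R / l%:R.
  rewrite /p1 /q1 sampleB (le_trans (sample_norm (Jge0 x) _)) //.
  apply: (@le_trans _ _ (sample (fun z => \sum_i 2 * B *
      ((z i == a)%:R + (z i == b)%:R)) (J := J x))).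
    by apply: (le_sample (Jge0 x)) => z _; exact: g_tperm.
  rewrite sample_sum.
  have -> : 4 * B * n%:R / l%:R = \sum_(i < n) 2 * B * (l%:R^-1 + l%:R^-1).
    by rewrite sumr_const card_ord -[RHS]mulr_natl; ring.
  apply: ler_sum => i _; rewrite sampleZ sampleD.
  rewrite !(sample_marginal (Jsum x) i (fun y => (y == _)%:R)).
  apply: ler_wpM2l; first by rewrite mulr_ge0.
  have pt u : \sum_y J x y * (y == u)%:R = J x u.
    rewrite (bigD1 u) //= eqxx mulr1 big1 ?addr0 // => y /negbTE ->.
    by rewrite mulr0.
  by rewrite !pt lerD // Jle.
have h2 : `|p2 - q2| <= 4 * B * n%:R / l%:R.
  rewrite /p2 /q2 -sumrB (le_trans (ler_norm_sum _ _ _)) //.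
  apply: (@le_trans _ _ (\sum_y \sum_i l%:R^-1 * (2 * B *
      ((window_site y i == a)%:R + (window_site y i == b)%:R)))).
    apply: ler_sum => y _; rewrite -mulrBr normrM ger0_norm ?Jge0 //.
    rewrite -mulr_sumr; apply: ler_pM; rewrite ?normr_ge0 ?Jge0 ?Jle //.
    exact: (g_tperm eta a b (fun i => window_site y i)).
  rewrite exchange_big /=.
  have -> : 4 * B * n%:R / l%:R = \sum_(i < n) l%:R^-1 * (2 * B * (1 + 1)).
    by rewrite sumr_const card_ord -[RHS]mulr_natl; ring.
  apply: ler_sum => i _; rewrite -!mulr_sumr.
  apply: ler_wpM2l; first by rewrite invr_ge0.
  apply: ler_wpM2l; first by rewrite mulr_ge0.
  rewrite big_split /=.
  have pt u : \sum_(y < N) (window_site y i == u)%:R <= 1 :> R.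
    have [[y0 Ey]|no] := pselect (exists y, window_site y i = u).
      rewrite (bigD1 y0) //= Ey eqxx big1 ?addr0 // => y yy0.
      case: (_ =P u) => // E; case/eqP: yy0.
      by apply: (@window_site_inj1 M N i); rewrite E Ey.
    rewrite big1 // => y _; case: eqP => // E; case: no; by exists y.
  exact: lerD.
have -> : p1 - p2 - (q1 - q2) = p1 - q1 - (p2 - q2) by ring.
have := ler_normB (p1 - q1) (p2 - q2); lra.
Qed.

Let L := (3 * l + M.*2)%N.
Let cost (x : 'I_N) : R :=
  \sum_(k < L) tv m (tperm (sh (window_start (M:=M) x) k) (ordS (sh (window_start (M:=M) x) k))).
Let in_window (x u : 'I_N) : bool :=
  [exists k : 'I_L.+1, u == sh (window_start (M:=M) x) k].

Let tv_weighted x u v : in_window x u -> in_window x v ->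
  tv (fun eta => m eta * closure_error eta x) (tperm u v) <=
  4 * B * cost x + 8 * B * n%:R / l%:R.
Proof.
move=> /existsP[i /eqP ->] /existsP[j /eqP ->].
have H := tv_tperm_window m (window_start (M:=M) x) (ltn_ord i : (i <= L)%N) (ltn_ord j : (j <= L)%N).
set s := tperm _ _ in H *.
apply: (@le_trans _ _ (2 * B * tv m s + 8 * B * n%:R / l%:R)); last first.
  rewrite lerD2r -[4]/(2 * 2)%:R natrM; rewrite -/(cost x) in H.
  have := ler_wpM2l (mulr_ge0 (ler0n _ 2) B_ge0) H; lra.
rewrite /tv mulr_sumr [X in _ + X]mavg -big_split /=.
apply: ler_sum => eta _.
set e' := permute s eta.
have -> : m e' * closure_error e' x - m eta * closure_error eta x =
    closure_error e' x * (m e' - m eta) +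
    m eta * (closure_error e' x - closure_error eta x) by ring.
rewrite (le_trans (ler_normD _ _)) // !normrM; apply: lerD.
  by apply: ler_wpM2r => //; exact: closure_error_le.
by rewrite [`|m eta|]ger0_norm //; apply: ler_wpM2l => //; exact: closure_error_tperm.
Qed.

Let closure_error_sqr x : \sum_eta m eta * closure_error eta x ^+ 2 <=
  B * (n%:R * (4 * B * cost x + 8 * B * n%:R / l%:R))
  + 4 * B ^+ 2 * (n%:R ^+ 2 / l%:R).
Proof.
set D := 4 * B * cost x + 8 * B * n%:R / l%:R.
pose T (z : {ffun 'I_n -> 'I_N}) y := \sum_eta (m eta * closure_error eta x) *
  (g (readings eta z) - g (window M y eta)).
have -> : \sum_eta m eta * closure_error eta x ^+ 2 =
    sample (fun z => \sum_y J x y * T z y) (J := J x).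
  transitivity (\sum_eta \sum_(z : {ffun 'I_n -> 'I_N}) m eta * closure_error eta x *
      ((\prod_i J x (z i)) *
       \sum_y J x y * (g (readings eta z) - g (window M y eta)))).
    by apply: eq_bigr => eta _; rewrite -mulr_sumr -/(sample _) -closure_errorE expr2 mulrA.
  rewrite exchange_big /=; apply: eq_bigr => z _.
  have -> : \sum_y J x y * T z y = \sum_eta m eta * closure_error eta x *
      \sum_y J x y * (g (readings eta z) - g (window M y eta)).
    under eq_bigr do rewrite /T mulr_sumr.
    rewrite exchange_big /=; apply: eq_bigr => eta _.
    by rewrite mulr_sumr; apply: eq_bigr => y _; ring.
  by rewrite mulr_sumr; apply: eq_bigr => eta _; rewrite mulrCA.
have D_ge0 : 0 <= D.
  rewrite addr_ge0 // ?divr_ge0 // !mulr_ge0 // sumr_ge0 // => k _; exact: tv_ge0.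
have winJ y : J x y != 0 -> exists2 j, (j < 3 * l)%N & y = sh x j.
  exact: kernel_supp.
have inJ y : J x y != 0 -> in_window x y.
  move=> /winJ[j jl ->]; apply/existsP.
  have kL : (M + j < L.+1)%N by rewrite /L; lia.
  by exists (Ordinal kL); rewrite /= -shD sh_window_start.
have inW y i : J x y != 0 -> in_window x (window_site (M:=M) y i).
  move=> /winJ[j jl ->]; apply/existsP.
  have kL : (j + i < L.+1)%N by rewrite /L; have := ltn_ord i; lia.
  by exists (Ordinal kL); rewrite /= window_siteE window_startS shD.
have Tle (z : {ffun 'I_n -> 'I_N}) y : (forall i, J x (z i) != 0) -> J x y != 0 ->
    T z y <= B * (n%:R * D) + 4 * B ^+ 2 * (~~ injectiveb z)%:R.
  move=> zJ yJ; have [zinj|_] := boolP (injectiveb z); last first.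
    apply: ler_wpDl; first by rewrite !mulr_ge0.
    have -> : 4 * B ^+ 2 * (~~ false)%:R = \sum_eta m eta * (4 * B ^+ 2).
      by rewrite -mavg mulr1.
    apply: ler_sum => eta _; rewrite -mulrA ler_wpM2l //.
    apply: (le_trans (ler_norm _)); rewrite normrM.
    have := ler_pM (normr_ge0 _) (normr_ge0 _) (closure_error_le eta x)
      (g_diff (readings eta z) (window M y eta)).
    by move/le_trans; apply; rewrite le_eqVlt; apply/orP; left; apply/eqP; ring.
  rewrite mulr0 addr0; apply: (le_trans (ler_norm _)).
  have [s sE sD] := transport (@window_site_inj M N y MN) (injectiveP _ zinj)
    (fun i => inW y i yJ) (fun i => inJ _ (zJ i)) (@tv_weighted x).
  rewrite (_ : T z y = \sum_eta (m eta * closure_error eta x) *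
      (g (window M y (permute s eta)) - g (window M y eta))).
    apply: (le_trans (tv_dual _ _ (fun eta => g_le (window M y eta)))).
    exact: ler_wpM2l.
  apply: eq_bigr => eta _; congr (_ * (g _ - _)).
  by rewrite window_permute; apply/ffunP => i; rewrite !ffunE sE.
apply: (@le_trans _ _ (sample (fun z => B * (n%:R * D) +
    4 * B ^+ 2 * (~~ injectiveb z)%:R) (J := J x))).
  apply: (le_sample (Jge0 x)) => z zJ.
  rewrite [leRHS](Javg x); apply: ler_sum => y _.
  have [->|yJ] := eqVneq (J x y) 0; first by rewrite !mul0r.
  by apply: ler_wpM2l; [exact: Jge0|exact: Tle].
rewrite sampleD sample_cst // sampleZ; apply: lerD => //.
apply: ler_wpM2l; first by rewrite mulr_ge0 // sqr_ge0.
by apply: sample_collision.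
Qed.

(** One factor of the square is kept. The other one compares [g] read at
    independent random sites with [g] read in a random window, and the sites can be
    moved onto the window by [2 M + 1] transpositions within an interval of length
    [3 l + 2 M]. Each of them changes the kept factor by order [1 / l] and the
    state by at most twice the sum of the exchange costs over the interval. *)
Lemma local_equilibrium :
  \sum_x \sum_eta m eta * closure_error eta x ^+ 2 <=
  4 * B ^+ 2 * n%:R * (3 * l + M.*2)%:R * C
  + 12 * B ^+ 2 * n%:R ^+ 2 * (N%:R / l%:R).
Proof.
apply: (@le_trans _ _ (\sum_x (4 * B ^+ 2 * n%:R * cost x +
    12 * B ^+ 2 * n%:R ^+ 2 / l%:R))).
  apply: ler_sum => x _; apply: (le_trans (closure_error_sqr x)).
  by rewrite le_eqVlt; apply/orP; left; apply/eqP; ring.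
rewrite big_split /= -mulr_sumr sumr_const card_ord; apply: lerD; last first.
  by rewrite -mulr_natr le_eqVlt; apply/orP; left; apply/eqP; ring.
rewrite -[leRHS]mulrA; apply: ler_wpM2l; first by rewrite !mulr_ge0 // sqr_ge0.
rewrite /cost exchange_big /=.
apply: (@le_trans _ _ (\sum_(k < L) C)); last first.
  by rewrite sumr_const card_ord mulr_natl.
apply: ler_sum => k _.
apply: (le_trans _ m_tv); rewrite le_eqVlt; apply/orP; left; apply/eqP.
transitivity (\sum_x tv m (tperm (sh x k) (ordS (sh x k)))).
  by rewrite [RHS](reindex_inj (@window_start_inj M N)).
by rewrite (sum_sh k (fun x => tv m (tperm x (ordS x)))).
Qed.

End local_equilibrium.

Arguments field {R N} l eta x.
Arguments closure_error {R M N} l g eta x.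

(** * The energy functional *)

Section polynomials.
Context {R : realType}.

(** [P] plays the role of a primitive of [p]. *)
Definition taylor2 (p : R -> R) (P : R -> R) (K : R) : Prop :=
  forall a b : R, 0 <= a <= 1 -> 0 <= b <= 1 ->
    `|P b - P a - p a * (b - a)| <= K * (b - a) ^+ 2 /\
    `|p b - p a| <= K * `|b - a|.

Let expr_taylor n (a b : R) : 0 <= a <= 1 -> 0 <= b <= 1 ->
  `|b ^+ n - a ^+ n - n%:R * a ^+ n.-1 * (b - a)| <= n%:R ^+ 2 * (b - a) ^+ 2.
Proof.
move=> a01 b01; elim: n => [|n IH].
  by rewrite !expr0 subrr !mul0r subrr normr0 expr0n /= mul0r.
have -> : b ^+ n.+1 - a ^+ n.+1 - n.+1%:R * a ^+ n.+1.-1 * (b - a) =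
    b * (b ^+ n - a ^+ n - n%:R * a ^+ n.-1 * (b - a)) +
    n%:R * a ^+ n.-1 * (b - a) ^+ 2.
  case: n {IH} => [|n]; first by rewrite !expr0 !expr1 /= !mul0r; ring.
  by rewrite /= !exprS -[n.+2]addn1 -[n.+1]addn1 !natrD; ring.
have a1 : 0 <= a ^+ n.-1 <= 1.
  by case/andP: a01 => a0 a1; rewrite exprn_ge0 ?exprn_ile1.
have n0 : 0 <= n%:R :> R by [].
set T := _ - _ - _ in IH *; set q := (b - a) ^+ 2 in IH *; set p := a ^+ n.-1 in a1 *.
have q0 : 0 <= q by exact: sqr_ge0.
rewrite (le_trans (ler_normD _ _)) // normrM ger0_norm; last by case/andP: b01.
have -> : `|n%:R * p * q| = n%:R * q * p.
  have p0 : 0 <= p by case/andP: a1.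
  by rewrite mulrAC ger0_norm //; apply: mulr_ge0 => //; exact: mulr_ge0.
have h1 : b * `|T| <= `|T| by rewrite ler_piMl //; case/andP: b01.
have h2 : n%:R * q * p <= n%:R * q.
  by apply: ler_piMr; [exact: mulr_ge0|case/andP: a1].
have -> : n.+1%:R ^+ 2 * q = n%:R ^+ 2 * q + n%:R * q + (n%:R * q + q).
  by rewrite -[n.+1]addn1 natrD; ring.
have : 0 <= n%:R * q by rewrite mulr_ge0.
lra.
Qed.

Let expr_lip n (a b : R) : 0 <= a <= 1 -> 0 <= b <= 1 ->
  `|b ^+ n - a ^+ n| <= n%:R * `|b - a|.
Proof.
move=> /andP[a0 a1] /andP[b0 b1].
elim: n => [|n IH]; first by rewrite !expr0 subrr normr0 mul0r.
have -> : b ^+ n.+1 - a ^+ n.+1 = b * (b ^+ n - a ^+ n) + a ^+ n * (b - a).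
  by rewrite !exprS; ring.
rewrite (le_trans (ler_normD _ _)) // !normrM (ger0_norm b0).
rewrite (ger0_norm (exprn_ge0 _ a0)) -[n.+1]addn1 natrD mulrDl mul1r lerD //.
  by rewrite (le_trans _ IH) // ler_piMl.
by rewrite ler_piMl // exprn_ile1.
Qed.

Lemma poly_taylor2 (p : {poly R}) :
  exists P K, 0 <= K /\ taylor2 (fun r => p.[r]) P K.
Proof.
rewrite -[p]coefK poly_def.
apply: (big_ind (fun q : {poly R} =>
  exists P K, 0 <= K /\ taylor2 (fun r => q.[r]) P K)).
- exists (fun=> 0), 0; split=> // a b _ _.
  by rewrite !horner0 !subrr !mul0r subrr !normr0.
- move=> q1 q2 [P1 [K1 [K10 T1]]] [P2 [K2 [K20 T2]]].
  exists (fun r => P1 r + P2 r), (K1 + K2); split; first exact: addr_ge0.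
  move=> a b ha hb; have [t1 l1] := T1 a b ha hb; have [t2 l2] := T2 a b ha hb.
  rewrite !hornerD !mulrDl; split.
    rewrite (_ : _ - _ = (P1 b - P1 a - q1.[a] * (b - a)) +
      (P2 b - P2 a - q2.[a] * (b - a))); last by ring.
    by rewrite (le_trans (ler_normD _ _)) // lerD.
  rewrite (_ : _ - _ = (q1.[b] - q1.[a]) + (q2.[b] - q2.[a])); last by ring.
  by rewrite (le_trans (ler_normD _ _)) // lerD.
move=> [i _] /= _; set k := p`_i.
exists (fun r => k * (r ^+ i.+1 / i.+1%:R)), (`|k| * i.+1%:R).
split; first by rewrite mulr_ge0.
have i0 : i.+1%:R != 0 :> R by rewrite pnatr_eq0.
move=> a b ha hb; rewrite !hornerZ !hornerXn; split.
  rewrite (_ : _ - _ = k * ((b ^+ i.+1 - a ^+ i.+1 -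
      i.+1%:R * a ^+ i.+1.-1 * (b - a)) / i.+1%:R)); last by rewrite /=; field.
  rewrite normrM -[leRHS]mulrA ler_wpM2l // normrM normfV (@ger0_norm _ i.+1%:R) //.
  rewrite ler_pdivrMr ?ltr0n // (le_trans (expr_taylor _ ha hb)) //.
  by rewrite le_eqVlt; apply/orP; left; apply/eqP; ring.
rewrite -mulrBr normrM -[leRHS]mulrA ler_wpM2l // (le_trans (expr_lip _ ha hb)) //.
by rewrite ler_wpM2r // ler_nat.
Qed.

End polynomials.

Section reaction.
Context {R : realType} {M : nat} (c : pattern M -> R).

(** The rate of change of the occupation at the centre of a window. *)
Definition spin_drift (xi : pattern M) : R :=
  (1 - 2 * (xi (window_center M))%:R) * c xi.

Lemma reactionE r : reaction c r = bernoulli_mean r spin_drift.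
Proof.
rewrite /reaction /birth /death /bernoulli_mean -sumrB.
apply: eq_bigr => xi _; rewrite /spin_drift; ring.
Qed.

Lemma reaction_poly : exists p : {poly R}, forall r, reaction c r = p.[r].
Proof.
exists (\sum_(xi : pattern M)
  (\prod_i (if xi i then 'X else 1 - 'X)) * (spin_drift xi)%:P) => r.
rewrite reactionE horner_sum; apply: eq_bigr => xi _.
rewrite hornerM hornerC horner_prod; congr (_ * _).
by apply: eq_bigr => i _; case: (xi i); rewrite ?hornerE.
Qed.

Lemma spin_drift_le (C : R) : (forall xi, 0 <= c xi <= C) ->
  forall xi, `|spin_drift xi| <= C.
Proof.
move=> cC xi; rewrite /spin_drift normrM.
have /andP[c0 c1] := cC xi; rewrite (ger0_norm c0).
case: (xi _) => /=.
  by rewrite mulr1n mulr1 (_ : 1 - 2 = -1) ?normrN1 ?mul1r //; ring.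
by rewrite mulr0n mulr0 subr0 normr1 mul1r.
Qed.

End reaction.

Section energy.
Context {R : realType} {M N l : nat} {c : pattern M -> R} {C : R}.
Context {P : R -> R} {K : R}.
Hypothesis c_bnd : forall xi, 0 <= c xi <= C.
Hypothesis l_gt0 : (0 < l)%N.
Hypothesis lN : (l <= N)%N.
Hypothesis K_ge0 : 0 <= K.
Hypothesis taylor : taylor2 (reaction c) P K.

Definition laplace (v : 'I_N -> R) (x : 'I_N) : R :=
  v (ordS x) + v (ord_pred x) - 2 * v x.

(** The discrete version of [(1/2) rho'' + F(rho)]. *)
Definition residual (v : 'I_N -> R) (x : 'I_N) : R :=
  N%:R ^+ 2 / 2 * laplace v x + reaction c (v x).

(** The Lyapunov functional of the limiting equation: its gradient is minus the
    residual, so that it decreases at the rate of the squared residual. *)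
Definition energy (v : 'I_N -> R) : R :=
  \sum_x (N%:R ^+ 2 / 4 * fwd v x ^+ 2 - P (v x)).

Lemma sum_fwd_laplace (v d : 'I_N -> R) :
  \sum_x fwd v x * fwd d x = - \sum_x laplace v x * d x.
Proof.
rewrite /fwd; under eq_bigr do rewrite mulrBr.
rewrite sumrB.
have -> : \sum_(x < N) (v (ordS x) - v x) * d (ordS x) =
    \sum_(x < N) (v x - v (ord_pred x)) * d x.
  rewrite [RHS](reindex_inj (@ordS_inj N)).
  by apply: eq_bigr => x _; rewrite ordSK.
rewrite -[RHS]sumrN -sumrB; apply: eq_bigr => x _; rewrite /laplace; ring.
Qed.

Lemma energy_le (v w : 'I_N -> R) :
  (forall x, 0 <= v x <= 1) -> (forall x, 0 <= w x <= 1) ->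
  energy w - energy v <= - \sum_x residual v x * (w x - v x) +
    \sum_x (N%:R ^+ 2 / 4 * fwd (fun y => w y - v y) x ^+ 2 +
            K * (w x - v x) ^+ 2).
Proof.
move=> v01 w01; set d := fun y => w y - v y.
have E : - \sum_x residual v x * d x =
    \sum_x (N%:R ^+ 2 / 2 * (fwd v x * fwd d x) - reaction c (v x) * d x).
  rewrite sumrB -mulr_sumr sum_fwd_laplace mulrN -opprD; congr (- _).
  rewrite mulr_sumr -big_split; apply: eq_bigr => x _; rewrite /residual /=; ring.
rewrite /energy -sumrB E -big_split /=; apply: ler_sum => x _.
have [t _] := taylor (v01 x) (w01 x).
have -> : fwd w x = fwd v x + fwd d x by rewrite /fwd /d; ring.
move: t; rewrite ler_norml => /andP[t _]; rewrite -[w x - v x]/(d x) in t *.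
set q := N%:R ^+ 2 in t *; lra.
Qed.

Lemma field01 (eta : config N) x : 0 <= field (R:=R) l eta x <= 1.
Proof.
apply/andP; split; first by do 3!apply: box_ge0 => {}x.
by apply: (le_trans (ler_norm _)); do 3!apply: box_norm => // {}x;
  case: (eta x); rewrite ?normr1 ?normr0.
Qed.

Let fieldB (eta eta' : config N) x :
  field l eta' x - field l eta x =
  box3 l (fun z => (eta' z)%:R - (eta z)%:R) x :> R.
Proof. by rewrite box3B. Qed.

Let spin (eta : config N) x : R := (eta x)%:R.

Let spin_exchange (eta : config N) y z :
  (exchange eta y (ordS y) z)%:R - spin eta z =
  (spin eta (ordS y) - spin eta y) * fwd (point (ordS y)) z.
Proof.
rewrite ffunE /fwd /point (inj_eq (@ordS_inj N)) /spin.
have [->|zy] := eqVneq z y.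
  have [E|_] := eqVneq y (ordS y); last by rewrite subr0 mulr1.
  by rewrite -E !subrr mul0r.
have [E|_] := eqVneq z (ordS y); last by rewrite !subrr mulr0.
by rewrite E sub0r mulrN mulr1 opprB.
Qed.

Let spin_flip (eta : config N) y z :
  (flip eta y z)%:R - spin eta z = (1 - 2 * spin eta y) * point y z.
Proof.
rewrite ffunE /point /spin; case: eqP => [->|_]; last by rewrite subrr mulr0.
by case: (eta y) => /=; rewrite ?mulr1n ?mulr0n; ring.
Qed.

Let spin_abs (eta : config N) x y : `|spin eta x - spin eta y| <= 1.
Proof.
by rewrite /spin; case: (eta x); case: (eta y);
  rewrite ?subrr ?sub0r ?subr0 ?normrN ?normr0 ?normr1.
Qed.

Let spin_abs' (eta : config N) y : `|1 - 2 * spin eta y| <= 1.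
Proof.
rewrite /spin; case: (eta y); rewrite ?mulr0 ?subr0 ?normr1 //.
by rewrite mulr1 (_ : 1 - 2 = -1) ?normrN1 //; ring.
Qed.

Let scaled_le (a x B : R) : `|a| <= 1 -> `|x| <= B -> `|a * x| <= B.
Proof. by move=> a1 xB; rewrite normrM (le_trans _ xB) // ler_piMl. Qed.

Let box3Z (a : R) (v : 'I_N -> R) x :
  box3 l (fun y => a * v y) x = a * box3 l v x.
Proof.
have := box3_sum l (fun _ : 'I_1 => a) (fun _ => v) x; rewrite big_ord1 => <-.
by apply: eq_box3 => y; rewrite big_ord1.
Qed.

Let fwd_eq (v w : 'I_N -> R) : v =1 w -> fwd v =1 fwd w.
Proof. by move=> vw x; rewrite /fwd !vw. Qed.

Let fwdZ (a : R) (v : 'I_N -> R) x : fwd (fun y => a * v y) x = a * fwd v x.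
Proof. by rewrite /fwd mulrBr. Qed.

Let bp z (x : 'I_N) := @box_point R N l l_gt0 lN z x.

Let field_exchange (eta : config N) y x :
  `|field l (exchange eta y (ordS y)) x - field l eta x| <=
  2 / l%:R * l%:R^-1 :> R.
Proof.
rewrite fieldB (eq_box3 _ (spin_exchange eta y)) box3Z.
by apply: scaled_le; [exact: spin_abs|exact: box3_fwd_norm].
Qed.

Let field_exchange_fwd (eta : config N) y x :
  `|fwd (fun x => field l (exchange eta y (ordS y)) x - field l eta x) x| <=
  2 / l%:R * (2 / l%:R * l%:R^-1) :> R.
Proof.
rewrite (@fwd_eq _ (fun x => (spin eta (ordS y) - spin eta y) *
  box3 l (fwd (point (ordS y))) x)) => [|z]; last first.
  by rewrite fieldB (eq_box3 _ (spin_exchange eta y)) box3Z.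
by rewrite fwdZ; apply: scaled_le; [exact: spin_abs|exact: fwd_box3_fwd_norm].
Qed.

Let field_flip (eta : config N) y x :
  `|field l (flip eta y) x - field l eta x| <= l%:R^-1 :> R.
Proof.
rewrite fieldB (eq_box3 _ (spin_flip eta y)) box3Z.
apply: scaled_le; first exact: spin_abs'.
by do 2!apply: box_norm => // {}x.
Qed.

Let field_flip_fwd (eta : config N) y x :
  `|fwd (fun x => field l (flip eta y) x - field l eta x) x| <=
  2 / l%:R * l%:R^-1 :> R.
Proof.
rewrite (@fwd_eq _ (fun x => (1 - 2 * spin eta y) * box3 l (point y) x)) => [|z].
  by rewrite fwdZ; apply: scaled_le; [exact: spin_abs'|exact: fwd_box3_norm].
by rewrite fieldB (eq_box3 _ (spin_flip eta y)) box3Z.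
Qed.

Lemma sh_ord_pred (x : 'I_N) i : sh (ord_pred x) i = ord_pred (sh x i).
Proof. by apply: (@ordS_inj N); rewrite -sh_ordS !ord_predK. Qed.

Let box_laplace (v : 'I_N -> R) x : box l (laplace v) x = laplace (box l v) x.
Proof.
rewrite /laplace /box [2 * (_ * _)]mulrCA -mulrDr -mulrBr [2 * _]mulr_sumr -big_split -sumrB /=.
by congr (_ * _); apply: eq_bigr => i _; rewrite sh_ordS sh_ord_pred.
Qed.

Let box3_laplace (v : 'I_N -> R) x :
  box3 l (laplace v) x = laplace (box3 l v) x.
Proof.
rewrite -box_laplace; apply: eq_box => y; rewrite -box_laplace.
by apply: eq_box => z; rewrite box_laplace.
Qed.

Let exchange_sum (eta : config N) z :
  \sum_y ((exchange eta y (ordS y) z)%:R - spin eta z) = laplace (spin eta) z.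
Proof.
under eq_bigr do rewrite spin_exchange /fwd /point mulrBr.
rewrite sumrB (bigD1 z) //= (inj_eq (@ordS_inj N)) eqxx mulr1 big1 => [|y yz].
  rewrite (bigD1 (ord_pred z)) //= ord_predK eqxx mulr1 big1 => [|y yz].
    by rewrite /laplace; ring.
  have [E|_] := eqVneq z (ordS y); last by rewrite mulr0.
  by rewrite E ordSK eqxx in yz.
by rewrite (inj_eq (@ordS_inj N)) eq_sym (negbTE yz) mulr0.
Qed.

(** The exchange part is exact because the Laplacian commutes with the averages;
    only the reaction part is not a function of the field. *)
Lemma generator_field (eta : config N) x :
  generator c (fun eta => field l eta x) eta =
  residual (field l eta) x - closure_error l (spin_drift c) eta x.
Proof.
rewrite /generator /residual /closure_error -reactionE.
under eq_bigr do rewrite fieldB.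
under [X in _ + X]eq_bigr do rewrite fieldB.
have -> : \sum_(y < N) box3 (R:=R) l (fun z => (exchange eta y (ordS y) z)%:R -
    (eta z)%:R) x = laplace (field (R:=R) l eta) x.
  transitivity (box3 (R:=R) l (fun z => \sum_y 1 *
      ((exchange eta y (ordS y) z)%:R - (eta z)%:R)) x).
    by rewrite box3_sum; apply: eq_bigr => y _; rewrite mul1r.
  rewrite -box3_laplace; apply: eq_box3 => z.
  by rewrite -exchange_sum; apply: eq_bigr => y _; rewrite mul1r.
rewrite -(box3_sum l (fun y => c (window M y eta))).
have -> : box3 l (fun y => \sum_i c (window M i eta) *
      ((flip eta i y)%:R - (eta y)%:R)) x =
    box3 l (fun y => spin_drift c (window M y eta)) x.
  apply: eq_box3 => z.
  under eq_bigr do rewrite spin_flip /point.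
  rewrite (bigD1 z) //= eqxx mulr1 big1 => [|y /negbTE yz]; last first.
    by rewrite eq_sym yz !mulr0.
  rewrite addr0 /spin_drift mulrC ffunE window_siteE /window_center inordK.
    by rewrite sh_window_start.
  by lia.
ring.
Qed.

(** A bound on the second order terms of the energy, summed over the exchanges and
    the flips with their rates. It is bounded when [N / l] is, whereas the drift of the
    energy is a sum of [N] terms. *)
Definition energy_noise : R :=
  N%:R ^+ 2 / 2 * (N%:R * (N%:R *
    (N%:R ^+ 2 / 4 * (2 / l%:R * (2 / l%:R * l%:R^-1)) ^+ 2 +
     K * (2 / l%:R * l%:R^-1) ^+ 2))) +
  N%:R * (C * (N%:R *
    (N%:R ^+ 2 / 4 * (2 / l%:R * l%:R^-1) ^+ 2 + K * l%:R^-1 ^+ 2))).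

Let cst_sum (q : R) : N%:R * q = \sum_(x < N) q.
Proof. by rewrite sumr_const card_ord mulr_natl. Qed.

Let quad_le (d : 'I_N -> R) (a b : R) : (forall x, `|fwd d x| <= a) ->
  (forall x, `|d x| <= b) ->
  \sum_x (N%:R ^+ 2 / 4 * fwd d x ^+ 2 + K * d x ^+ 2) <=
  N%:R * (N%:R ^+ 2 / 4 * a ^+ 2 + K * b ^+ 2).
Proof.
move=> da db; rewrite [leRHS]cst_sum.
have sq (u v : R) : `|u| <= v -> u ^+ 2 <= v ^+ 2.
  by move=> uv; rewrite -[u ^+ 2]real_normK ?num_real // ler_sqr ?nnegrE //;
    exact: le_trans uv.
apply: ler_sum => x _; apply: lerD; apply: ler_wpM2l; rewrite ?sq //.
Qed.

Lemma generator_energy (eta : config N) :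
  generator c (fun eta => energy (field l eta)) eta <=
  - \sum_x residual (field l eta) x *
      generator c (fun eta => field l eta x) eta + energy_noise.
Proof.
set v := field l eta; set r := residual v.
have -> : \sum_x r x * generator c (fun eta => field l eta x) eta =
    N%:R ^+ 2 / 2 * \sum_y \sum_x
      r x * (field l (exchange eta y (ordS y)) x - v x) +
    \sum_y c (window M y eta) * \sum_x r x * (field l (flip eta y) x - v x).
  rewrite /generator; under eq_bigr do rewrite mulrDr.
  rewrite big_split /=; congr (_ + _).
    rewrite exchange_big /= mulr_sumr; apply: eq_bigr => x _.
    by rewrite mulrCA; congr (_ * _); rewrite mulr_sumr.
  under eq_bigr do rewrite mulr_sumr.
  rewrite exchange_big /=; apply: eq_bigr => y _; rewrite mulr_sumr.
  by apply: eq_bigr => x _; rewrite mulrCA.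
rewrite /generator /energy_noise opprD addrACA; apply: lerD.
  rewrite -mulrN -mulrDr; apply: ler_wpM2l; first by rewrite divr_ge0 ?exprn_ge0.
  rewrite [X in _ <= _ + X]cst_sum -[X in _ <= X + _]sumrN.
  rewrite -big_split; apply: ler_sum => y _ /=.
  apply: (le_trans (energy_le (field01 _) (field01 _))).
  rewrite lerD2l; apply: quad_le => x; [exact: field_exchange_fwd|].
  exact: field_exchange.
rewrite [X in _ <= _ + X]cst_sum -[X in _ <= X + _]sumrN.
rewrite -big_split; apply: ler_sum => y _ /=.
set Q := N%:R * _.
have /andP[c0 cC] := c_bnd (window M y eta).
have Q0 : 0 <= Q.
  apply: mulr_ge0 => //; apply: addr_ge0; apply: mulr_ge0 => //;
    rewrite ?exprn_ge0 ?invr_ge0 // ?divr_ge0 ?exprn_ge0 ?mulr_ge0 ?invr_ge0 //.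
apply: (@le_trans _ _ (c (window M y eta) *
    (- (\sum_x r x * (field l (flip eta y) x - v x)) + Q))); last first.
  by rewrite mulrDr mulrN lerD2l ler_wpM2r.
apply: ler_wpM2l => //; apply: (le_trans (energy_le (field01 _) (field01 _))).
rewrite lerD2l; apply: quad_le => x; [exact: field_flip_fwd|].
exact: field_flip.
Qed.

Context {m : config N -> R}.
Hypothesis m_ge0 : forall eta, 0 <= m eta.
Hypothesis m_sum : \sum_eta m eta = 1.
Hypothesis stat : forall f, \sum_eta m eta * generator c f eta = 0.

(** In the stationary state the mean energy is constant, while its drift is
    minus the squared residual up to the closure error and the noise. *)
Lemma residual_sqr :
  \sum_eta m eta * \sum_x residual (field l eta) x ^+ 2 <=
  \sum_x \sum_eta m eta *
    closure_error l (spin_drift c) eta x ^+ 2 + 2 * energy_noise.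
Proof.
pose r eta := residual (field l eta).
pose e (eta : config N) := closure_error l (spin_drift c) eta.
have : 0 <= \sum_eta m eta *
    (- \sum_x r eta x * (r eta x - e eta x) + energy_noise).
  apply: (@le_trans _ _ (\sum_eta m eta *
      generator c (fun eta => energy (field l eta)) eta)); first by rewrite stat.
  apply: ler_sum => eta _; apply: ler_wpM2l => //.
  apply: (le_trans (generator_energy eta)); rewrite lerD2r lerN2.
  by apply: ler_sum => x _; rewrite generator_field.
rewrite exchange_big /=.
under [X in _ -> _ <= X + _]eq_bigr do rewrite -mulr_sumr.
set S := \sum_eta m eta * \sum_x _ ^+ 2; set T := \sum_eta m eta * \sum_x _ ^+ 2.
move=> h; suff : \sum_eta m eta *
    (- \sum_x r eta x * (r eta x - e eta x) + energy_noise) <=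
    - (S / 2) + T / 2 + energy_noise by lra.
have pt eta : - \sum_x r eta x * (r eta x - e eta x) <=
    - (\sum_x r eta x ^+ 2) / 2 + (\sum_x e eta x ^+ 2) / 2.
  rewrite -mulrDl ler_pdivlMr // -!sumrN -big_split mulr_suml.
  apply: ler_sum => x _ /=; have := sqr_ge0 (r eta x - e eta x); lra.
have -> : - (S / 2) + T / 2 + energy_noise = \sum_eta m eta *
    (- (\sum_x r eta x ^+ 2) / 2 + (\sum_x e eta x ^+ 2) / 2 + energy_noise).
  move: energy_noise => noise; rewrite /S /T !mulr_suml -sumrN.
  rewrite [X in _ + X = _](_ : noise = \sum_eta m eta * noise); last first.
    by rewrite -mulr_suml m_sum mul1r.
  by rewrite -!big_split /=; apply: eq_bigr => eta _; ring.
by apply: ler_sum => eta _; rewrite ler_wpM2l // lerD2r.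
Qed.

End energy.

Arguments residual {R M N} c v x.

(** * Almost solutions of the lattice equation *)

Section lattice.
Context {R : realType} {M : nat} {c : pattern M -> R} {N' : nat}.
Notation N := N'.+1.
Context {v : 'I_N -> R} {B K k : R}.
Hypothesis v01 : forall x, 0 <= v x <= 1.
Hypothesis F_le : forall r : R, 0 <= r <= 1 -> `|reaction c r| <= B.
Hypothesis F_lip : forall r s : R, 0 <= r <= 1 -> 0 <= s <= 1 ->
  `|reaction c s - reaction c r| <= K * `|s - r|.
Hypothesis K_ge0 : 0 <= K.
Hypothesis k_ge0 : 0 <= k.
Hypothesis k_le1 : k <= 1.
Hypothesis small : \sum_x `|residual c v x| <= k * N%:R.

(** The lattice profile is unrolled to a periodic function on the integers. *)
Definition site (z : int) : 'I_N := inord `|(z %% N)%Z|%N.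

Lemma val_site z : site z = `|(z %% N)%Z|%N :> nat.
Proof. by rewrite inordK // -ltz_nat gez0_abs ?modz_ge0 // ltz_pmod. Qed.

Lemma siteS z : site (z + 1) = ordS (site z).
Proof.
apply: ord_inj; rewrite val_site /= val_site.
have : 0 <= (z %% N)%Z by rewrite modz_ge0.
rewrite -modzDml; case: (z %% N)%Z => [r _|//].
by rewrite -PoszD modz_nat !absz_nat addn1.
Qed.

Lemma site_period z : site (z + N%:Z) = site z.
Proof. by rewrite /site modzDr. Qed.

Lemma site_nat (x : 'I_N) : site x%:Z = x.
Proof. by apply: ord_inj; rewrite val_site modz_nat absz_nat modn_small. Qed.

Lemma siteD z j : site (z + j%:Z) = sh (site z) j.
Proof.
elim: j => [|j IH]; first by rewrite addr0.
have -> : z + j.+1%:Z = z + j%:Z + 1 by rewrite -addn1 PoszD addrA.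
by rewrite siteS IH -shS.
Qed.

Definition profile (z : int) : R := v (site z).
Definition slope (z : int) : R := N%:R * (profile (z + 1) - profile z).

Local Notation psi := profile.
Local Notation a := (fun z => residual c v (site z)).
Local Notation F := (reaction c).

Let N0 : 0 < N%:R :> R. Proof. by rewrite ltr0n. Qed.

Let psi01 z : 0 <= psi z <= 1. Proof. exact: v01. Qed.

Let B_ge0 : 0 <= B. Proof. exact: le_trans (F_le (psi01 0)). Qed.

Let sum_period (g : 'I_N -> R) z : \sum_(j < N) g (site (z + j%:Z)) = \sum_x g x.
Proof.
under eq_bigr do rewrite siteD.
have inj : injective (fun j : 'I_N => sh (site z) j).
  by move=> i j /sh_inj2 E; apply: val_inj; apply: E.
by rewrite [RHS](reindex_inj inj).
Qed.

Let telescope (f : int -> R) z j :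
  f (z + j%:Z) - f z = \sum_(i < j) (f (z + i%:Z + 1) - f (z + i%:Z)).
Proof.
elim: j => [|j IH]; first by rewrite big_ord0 addr0 subrr.
rewrite big_ord_recr /= -IH -addn1 PoszD addrA; ring.
Qed.

Let slope_step z :
  slope (z + 1) - slope z = 2 / N%:R * a (z + 1) - 2 / N%:R * F (psi (z + 1)).
Proof.
by rewrite /slope /residual /laplace /psi !siteS ordSK; field.
Qed.

Let residual_sum z j : (j <= N)%N ->
  `|\sum_(i < j) 2 / N%:R * a (z + i%:Z + 1)| <= 2 * k.
Proof.
move=> jN; rewrite -mulr_sumr normrM ger0_norm ?divr_ge0 //.
have h : `|\sum_(i < j) a (z + i%:Z + 1)| <= k * N%:R.
  apply: (le_trans _ small); rewrite -(sum_period _ (z + 1)).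
  rewrite (le_trans (ler_norm_sum _ _ _)) //.
  rewrite -(big_mkord predT (fun i => `|a (z + i%:Z + 1)|)).
  rewrite -(big_mkord predT (fun i => `|residual c v (site (z + 1 + i%:Z))|)).
  rewrite (big_cat_nat (n := j) (p := N)) //= addrC -lerBlDr.
  under [X in _ - X]eq_bigr => i _ do rewrite addrAC.
  rewrite subrr sumr_ge0 //.
have -> : 2 * k = 2 / N%:R * (k * N%:R) by field.
by rewrite ler_wpM2l ?divr_ge0.
Qed.

Lemma slope_diff z j : (j <= N)%N ->
  `|slope (z + j%:Z) - slope z| <= 2 * B * (j%:R / N%:R) + 2 * k.
Proof.
move=> jN; rewrite telescope.
under eq_bigr do rewrite slope_step.
rewrite sumrB addrC (le_trans (ler_normD _ _)) // normrN lerD ?residual_sum //.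
rewrite (le_trans (ler_norm_sum _ _ _)) //.
have -> : 2 * B * (j%:R / N%:R) = \sum_(i < j) 2 / N%:R * B.
  by rewrite sumr_const card_ord -[RHS]mulr_natl; field.
apply: ler_sum => i _; rewrite normrM ger0_norm ?divr_ge0 //.
by rewrite ler_wpM2l ?divr_ge0 ?F_le.
Qed.

Let D : R := 2 * B + 2.

(** The slope has mean zero over a period, so it is bounded by its
    oscillation. *)
Lemma slope_le z : `|slope z| <= D.
Proof.
have S0 : \sum_(j < N) slope (z + j%:Z) = 0.
  rewrite /slope -mulr_sumr -telescope /psi site_period subrr mulr0 //.
have : N%:R * slope z = \sum_(j < N) (slope z - slope (z + j%:Z)).
  by rewrite sumrB S0 subr0 sumr_const card_ord mulr_natl.
move=> E; rewrite -(ler_pM2l N0) -{1}[N%:R]ger0_norm // -normrM E.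
rewrite (le_trans (ler_norm_sum _ _ _)) //.
have -> : N%:R * D = \sum_(j < N) D by rewrite sumr_const card_ord mulr_natl.
apply: ler_sum => j _; rewrite distrC (le_trans (slope_diff _ _)) 1?ltnW //.
rewrite /D lerD //; last by rewrite ler_piMr.
by rewrite ler_piMr ?mulr_ge0 // ler_pdivrMr // mul1r ler_nat ltnW.
Qed.

Let psi_step z : psi (z + 1) - psi z = N%:R^-1 * slope z.
Proof. by rewrite /slope mulKf. Qed.

Lemma profile_diff z j : `|psi (z + j%:Z) - psi z| <= D * (j%:R / N%:R).
Proof.
rewrite telescope; under eq_bigr do rewrite psi_step.
rewrite (le_trans (ler_norm_sum _ _ _)) //.
have -> : D * (j%:R / N%:R) = \sum_(i < j) N%:R^-1 * D.
  by rewrite sumr_const card_ord -[RHS]mulr_natl; field.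
apply: ler_sum => i _; rewrite normrM ger0_norm ?invr_ge0 //.
by rewrite ler_wpM2l ?invr_ge0 ?slope_le.
Qed.

Let j_sqr (j : nat) (E : R) :
  E * (j%:R / N%:R) ^+ 2 = \sum_(i < j) N%:R^-1 * (E * (j%:R / N%:R)).
Proof. by rewrite sumr_const card_ord -[RHS]mulr_natl; field. Qed.

Lemma slope_taylor z j : (j <= N)%N ->
  `|slope (z + j%:Z) - slope z + 2 * F (psi z) * (j%:R / N%:R)| <=
  2 * k + 2 * K * D * (j%:R / N%:R) ^+ 2.
Proof.
move=> jN; rewrite telescope.
under eq_bigr do rewrite slope_step.
have -> : 2 * F (psi z) * (j%:R / N%:R) = \sum_(i < j) 2 / N%:R * F (psi z).
  by rewrite sumr_const card_ord -[RHS]mulr_natl; field.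
rewrite -big_split /=.
under eq_bigr do rewrite -addrA.
rewrite big_split /= (le_trans (ler_normD _ _)) // lerD ?residual_sum //.
rewrite j_sqr (le_trans (ler_norm_sum _ _ _)) //; apply: ler_sum => i _.
rewrite addrC -mulrBr normrM ger0_norm ?divr_ge0 //.
rewrite distrC [2 / _]mulrC -[leLHS]mulrA; apply: ler_wpM2l; first by rewrite invr_ge0.
rewrite -2![leRHS]mulrA ler_pM2l // (le_trans (F_lip _ _)) // ler_wpM2l //.
rewrite -addrA -[1]/(1%:Z) -PoszD (le_trans (profile_diff _ _)) //.
rewrite ler_wpM2l ?addr_ge0 ?mulr_ge0 // ler_wpM2r ?invr_ge0 //.
by rewrite ler_nat addn1.
Qed.

Lemma profile_taylor z j : (j <= N)%N ->
  `|psi (z + j%:Z) - psi z - slope z * (j%:R / N%:R)| <=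
  2 * k + 2 * B * (j%:R / N%:R) ^+ 2.
Proof.
move=> jN; rewrite telescope; under eq_bigr do rewrite psi_step.
have -> : slope z * (j%:R / N%:R) = \sum_(i < j) N%:R^-1 * slope z.
  by rewrite sumr_const card_ord -[RHS]mulr_natl; field.
rewrite -sumrB (le_trans (ler_norm_sum _ _ _)) //.
have : \sum_(i < j) N%:R^-1 * (2 * B * (j%:R / N%:R) + 2 * k) <=
    2 * k + 2 * B * (j%:R / N%:R) ^+ 2.
  under eq_bigr do rewrite mulrDr.
  rewrite big_split /= -j_sqr addrC lerD2r sumr_const card_ord -[leLHS]mulr_natl.
  rewrite mulrA ler_piMl ?mulr_ge0 // ler_pdivrMr // mul1r ler_nat //.
apply: le_trans; apply: ler_sum => i _.
rewrite -mulrBr normrM ger0_norm ?invr_ge0 // ler_wpM2l ?invr_ge0 //.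
have iN : (i <= N)%N by rewrite (leq_trans (ltnW (ltn_ord i))).
rewrite (le_trans (slope_diff z iN)) // lerD2r ler_wpM2l ?mulr_ge0 //.
by rewrite ler_wpM2r ?invr_ge0 // ler_nat ltnW.
Qed.

End lattice.

(** * Compactness *)

Section ultralimits.
Context {R : realType} {U : set_system nat} {UU : UltraFilter U}.

#[local] Instance ultra_proper_filter : ProperFilter U := ultra_proper.

(** An ultrafilter selects the limits at all points at once, without extraction
    of subsequences. *)
Lemma ultra_bounded_cvg (a : nat -> R) (C : R) :
  (forall n, `|a n| <= C) -> cvg (a @ U).
Proof.
move=> aC; have UC : (a @ U) `[- C, C]%classic.
  by apply: (@filterE _ U) => n /=; rewrite in_itv /= -ler_norml aC.
have [l [_ Cl]] := @segment_compact R (- C) C (a @ U) _ UC.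
apply: (cvgP l) => A Al; have [//|UA] := in_ultra_setVsetC (a @^-1` A) UU.
by have [x []] := Cl (~` A) A UA Al.
Qed.

End ultralimits.

Section taylor_derivative.
Context {R : realType}.

Lemma taylor_is_derive (f g : R -> R) (E : R) :
  (forall u w, `|w - u| < 1 -> `|f w - f u - g u * (w - u)| <= E * (w - u) ^+ 2) ->
  forall u : R, is_derive u (1 : R) f (g u).
Proof.
move=> H u.
have E0 : 0 <= E.
  have h : `|(2^-1 : R) - 0| < 1.
    by rewrite subr0 ger0_norm ?invr_ge0 // invf_lt1 // ltr1n.
  have := le_trans (normr_ge0 _) (H 0 2^-1 h).
  by rewrite subr0 pmulr_lge0 // exprn_gt0 // invr_gt0.
have L : h^-1 *: ((f \o shift u) (h *: 1) - f u) @[h --> 0^'] --> g u.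
  apply/cvgrPdist_le => e e0.
  have E1 : 0 < E + 1 by lra.
  have d0 : 0 < Num.min 1 (e / (E + 1)) by rewrite lt_min ltr01 divr_gt0.
  near=> h.
  have h0 : h != 0 by near: h; exact: nbhs_dnbhs_neq.
  have hd : `|h| < Num.min 1 (e / (E + 1)).
    near: h; apply: dnbhs0_lt; exact: d0.
  move: hd; rewrite lt_min => /andP[h1 he].
  rewrite /= /shift /= [h *: 1]mulr1.
  have := H u (h + u); rewrite addrK => /(_ h1) Hh.
  have -> : g u - h^-1 *: (f (h + u) - f u) =
      - (h^-1 * (f (h + u) - f u - g u * h)).
    rewrite -[_ *: _]/(_ * _); by field.
  rewrite normrN normrM normfV ler_pdivrMl ?normr_gt0 //.
  rewrite (le_trans Hh) // -[h ^+ 2]real_normK ?num_real // expr2 mulrCA.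
  rewrite ler_wpM2l // ltW // (le_lt_trans _ (_ : (E + 1) * `|h| < e)) //.
    by rewrite ler_wpM2r // lerDl.
  by rewrite -ltr_pdivlMl // mulrC.
by apply: DeriveDef; [exact: cvgP L|exact: cvg_lim L].
Unshelve. all: by end_near.
Qed.

Lemma lipschitz_continuous (f : R -> R) (D : R) :
  (forall u w, `|f w - f u| <= D * `|w - u|) -> continuous f.
Proof.
move=> H u; apply/cvgrPdist_le => e e0.
have D0 : 0 <= D.
  by have := le_trans (normr_ge0 _) (H 0 1); rewrite subr0 normr1 mulr1.
have D1 : 0 < D + 1 by lra.
near=> w; rewrite distrC (le_trans (H u w)) //.
have : `|u - w| < e / (D + 1).
  near: w; apply: cvgr_dist_lt; last by rewrite divr_gt0.
  exact: cvg_id.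
rewrite distrC ltr_pdivlMr // => h; have := normr_ge0 (w - u); nra.
Unshelve. all: by end_near.
Qed.

End taylor_derivative.

(** The equation passes to the limit in the form of second order expansions
    between two points: the limits satisfy the same inequalities without the
    residual, which makes them differentiable with the expected derivatives. *)
Section lattice_limit.
Context {R : realType} {M : nat} {c : pattern M -> R} {B K : R}.
Hypothesis F_le : forall r : R, 0 <= r <= 1 -> `|reaction c r| <= B.
Hypothesis F_lip : forall r s : R, 0 <= r <= 1 -> 0 <= s <= 1 ->
  `|reaction c s - reaction c r| <= K * `|s - r|.
Hypothesis K_ge0 : 0 <= K.
Context {U : set_system nat} {UU : UltraFilter U}.
Hypothesis U_oo : \oo `<=` U.
Context {size : nat -> nat} {v : forall n, 'I_(size n).+1 -> R}.
Hypothesis size_ge : forall n, (n <= size n)%N.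
Hypothesis v01 : forall n x, 0 <= v (n := n) x <= 1.
Hypothesis small : forall n,
  \sum_x `|residual c (@v n) x| <= harmonic n * (size n).+1%:R.

#[local] Instance ultra_limit_proper : ProperFilter U := ultra_proper.

Local Notation N n := ((size n).+1%:R : R).
Local Notation psi n := (profile (v := @v n)).
Local Notation sl n := (slope (v := @v n)).
Local Notation F := (reaction c).

Definition lattice_floor (n : nat) (u : R) : int := Num.floor (u * N n).

Definition limit_profile (u : R) : R := lim (psi n (lattice_floor n u) @[n --> U]).
Definition limit_slope (u : R) : R := lim (sl n (lattice_floor n u) @[n --> U]).

Local Notation rho := limit_profile.
Local Notation p := limit_slope.

Let D : R := 2 * B + 2.

Let near_mono (P Q : nat -> Prop) : (forall n, P n -> Q n) ->
  (\forall n \near U, P n) -> \forall n \near U, Q n.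
Proof. by move=> PQ; exact: (filterS (F := U) (P := P)). Qed.

Let lim_le (f g : nat -> R) (a b : R) : f n @[n --> U] --> a ->
  g n @[n --> U] --> b -> (\forall n \near U, f n <= g n) -> a <= b.
Proof. exact: ler_cvg_to. Qed.

Let N_gt0 n : 0 < N n. Proof. by rewrite ltr0n. Qed.

Let h_ge0 n : 0 <= harmonic n :> R. Proof. by rewrite invr_ge0. Qed.

Let h_le1 n : harmonic n <= 1 :> R.
Proof. by rewrite invf_le1 // ler1n. Qed.

Let B_ge0 : 0 <= B.
Proof. by apply: le_trans (F_le (r := 0) _); rewrite ?lexx ?ler01. Qed.

Let F_cont r : {for r, continuous F}.
Proof.
have [q Fq] := reaction_poly c.
have -> : reaction c = horner q by apply/funext => s; exact: Fq.
exact: continuous_horner.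
Qed.

Let cvg_psi u : psi n (lattice_floor n u) @[n --> U] --> rho u.
Proof.
apply: (@ultra_bounded_cvg _ _ _ _ 1) => n.
by rewrite ger0_norm; case/andP: (v01 (site (N' := size n) (lattice_floor n u))).
Qed.

Let cvg_slope u : sl n (lattice_floor n u) @[n --> U] --> p u.
Proof.
apply: (@ultra_bounded_cvg _ _ _ _ D) => n.
exact: (slope_le (@v01 n) F_le (h_le1 n) (small n)).
Qed.

Let cvg_h : harmonic n @[n --> U] --> (0 : R).
Proof. by move=> A /cvg_harmonic HA; apply: U_oo. Qed.

Let cvg_Ninv : (N n)^-1 @[n --> U] --> (0 : R).
Proof.
apply: squeeze_cvgr cvg_h; last exact: cvg_cst.
apply: filterE => n; rewrite invr_ge0 ltW //=.
by rewrite lef_pV2 ?posrE // ler_nat ltnS.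
Qed.

Let rho01 u : 0 <= rho u <= 1.
Proof.
apply/andP; split.
  apply: (cvgr_to_ge (@cvg_psi u)); apply: filterE => n.
  by case/andP: (v01 (site (N' := size n) (lattice_floor n u))).
apply: (cvgr_to_le (@cvg_psi u)); apply: filterE => n.
by case/andP: (v01 (site (N' := size n) (lattice_floor n u))).
Qed.

Let steps (u w : R) (n : nat) : nat := `|lattice_floor n w - lattice_floor n u|%N.

Let cellE u w n : u <= w -> lattice_floor n w = lattice_floor n u + (steps u w n)%:Z.
Proof.
move=> uw; rewrite /steps gez0_abs; first by rewrite addrCA subrr addr0.
by rewrite subr_ge0 le_floor // ler_wpM2r.
Qed.

Let steps_near u w n : u <= w ->
  `|(steps u w n)%:R / N n - (w - u)| <= (N n)^-1.
Proof.
move=> uw.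
have -> : (steps u w n)%:R = (lattice_floor n w)%:~R - (lattice_floor n u)%:~R :> R.
  by rewrite (cellE n uw) intrD addrC addKr.
have /andP[w1 w2] := floor_itv (w * N n).
have /andP[u1 u2] := floor_itv (u * N n).
rewrite -/(lattice_floor n w) in w1 w2; rewrite -/(lattice_floor n u) in u1 u2.
rewrite intrD in w2; rewrite intrD in u2.
set a : R := (lattice_floor n w)%:~R in w1 w2 *; set b : R := (lattice_floor n u)%:~R in u1 u2 *.
have -> : (a - b) / N n - (w - u) = (a - b - (w * N n - u * N n)) / N n.
  by field; rewrite gt_eqF.
rewrite normrM [`|(N n)^-1|]gtr0_norm ?invr_gt0 // ler_piMl ?invr_ge0 ?ltW //.
rewrite ltr_norml; lra.
Qed.

Let cvg_steps u w : u <= w -> (steps u w n)%:R / N n @[n --> U] --> w - u.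
Proof.
move=> uw; apply/cvgrPdist_le => e e0.
have H : \forall n \near U, (N n)^-1 < e by exact: (cvgr_lt _ cvg_Ninv _ e0).
refine (@near_mono _ _ _ H) => n /ltW; apply: le_trans.
by rewrite distrC steps_near.
Qed.

Let steps_le u w : u <= w -> w - u < 1 ->
  \forall n \near U, (steps u w n <= (size n).+1)%N.
Proof.
move=> uw wu; have H : \forall n \near U, (steps u w n)%:R / N n < 1.
  exact: (cvgr_lt _ (cvg_steps uw) _ wu).
by refine (near_mono _ H) => n; rewrite ltr_pdivrMr // mul1r ltr_nat => /ltnW.
Qed.

Let rho_lip_le u w : u <= w -> `|rho w - rho u| <= D * (w - u).
Proof.
move=> uw; apply: (@lim_le (fun n => `|psi n (lattice_floor n w) - psi n (lattice_floor n u)|)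
    (fun n => D * ((steps u w n)%:R / N n))).
- by apply: cvg_norm; apply: cvgB.
- by apply: cvgMr; exact: cvg_steps.
- apply: filterE => n; rewrite (cellE n uw).
  exact: (profile_diff (@v01 n) F_le (h_le1 n) (small n)).
Qed.

Let rho_lip u w : `|rho w - rho u| <= D * `|w - u|.
Proof.
wlog uw : u w / u <= w => [W|].
  have [|/ltW wu] := leP u w; first exact: W.
  by rewrite distrC [`|w - u|]distrC; exact: W.
by rewrite [`|w - u|]ger0_norm ?subr_ge0 // rho_lip_le.
Qed.

Let slope_lip_le u w : u <= w -> w - u < 1 -> `|p w - p u| <= 2 * B * (w - u).
Proof.
move=> uw wu; rewrite -[leRHS]addr0 -(mulr0 2).
apply: (@lim_le (fun n => `|sl n (lattice_floor n w) - sl n (lattice_floor n u)|)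
    (fun n => 2 * B * ((steps u w n)%:R / N n) + 2 * harmonic n)).
- by apply: cvg_norm; apply: cvgB.
- by apply: cvgD; apply: cvgMr => //; exact: cvg_steps.
- refine (near_mono _ (steps_le uw wu)) => n sn; rewrite (cellE n uw).
  exact: (slope_diff (@v01 n) F_le (small n)).
Qed.

Let rho_taylor_le u w : u <= w -> w - u < 1 ->
  `|rho w - rho u - p u * (w - u)| <= 2 * B * (w - u) ^+ 2.
Proof.
move=> uw wu; rewrite -[leRHS]add0r -(mulr0 2).
apply: (@lim_le (fun n => `|psi n (lattice_floor n w) - psi n (lattice_floor n u) -
      sl n (lattice_floor n u) * ((steps u w n)%:R / N n)|)
    (fun n => 2 * harmonic n + 2 * B * ((steps u w n)%:R / N n) ^+ 2)).
- by apply: cvg_norm; apply: cvgB; [exact: cvgB|apply: cvgM => //; exact: cvg_steps].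
- apply: cvgD; apply: cvgMr => //.
  by rewrite expr2; under eq_fun do rewrite expr2; apply: cvgM; exact: cvg_steps.
- refine (near_mono _ (steps_le uw wu)) => n sn; rewrite (cellE n uw).
  exact: (profile_taylor (@v01 n) F_le (h_ge0 n) (small n)).
Qed.

Let slope_taylor_le u w : u <= w -> w - u < 1 ->
  `|p w - p u + 2 * F (rho u) * (w - u)| <= 2 * K * D * (w - u) ^+ 2.
Proof.
move=> uw wu; rewrite -[leRHS]add0r -(mulr0 2).
apply: (@lim_le (fun n => `|sl n (lattice_floor n w) - sl n (lattice_floor n u) +
      2 * F (psi n (lattice_floor n u)) * ((steps u w n)%:R / N n)|)
    (fun n => 2 * harmonic n + 2 * K * D * ((steps u w n)%:R / N n) ^+ 2)).
- apply: cvg_norm; apply: cvgD; first exact: cvgB.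
  apply: cvgM; last exact: cvg_steps.
  apply: cvgMr.
  exact: (continuous_cvg _ (@F_cont (rho u)) (@cvg_psi u)).
- apply: cvgD; apply: cvgMr => //.
  by rewrite expr2; under eq_fun do rewrite expr2; apply: cvgM; exact: cvg_steps.
- refine (near_mono _ (steps_le uw wu)) => n sn; rewrite (cellE n uw).
  exact: (slope_taylor (@v01 n) F_le F_lip K_ge0 (h_le1 n) (small n)).
Qed.

(* A step to the left is a step to the right seen from its end point. *)
Let rho_derive u : is_derive u (1 : R) rho (p u).
Proof.
apply: (@taylor_is_derive _ rho p (4 * B)) => {}u w.
have [uw|/ltW wu] := leP u w.
  rewrite ger0_norm ?subr_ge0 // => h; apply: (le_trans (rho_taylor_le uw h)).
  by rewrite ler_wpM2r ?sqr_ge0 // ler_wpM2r // ler_nat.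
rewrite distrC ger0_norm ?subr_ge0 // => h.
have t := rho_taylor_le wu h; have s := slope_lip_le wu h.
have -> : rho w - rho u - p u * (w - u) =
    - (rho u - rho w - p w * (u - w)) + (p u - p w) * (u - w) by ring.
rewrite (le_trans (ler_normD _ _)) // normrN normrM.
rewrite [`|u - w|]ger0_norm ?subr_ge0 //.
have := ler_wpM2r (_ : 0 <= u - w) s; rewrite subr_ge0 => /(_ wu).
set q := `|_ - _ - _| in t *; nra.
Qed.

Let slope_derive u : is_derive u (1 : R) p (- 2 * F (rho u)).
Proof.
apply: (@taylor_is_derive _ p (fun u => - 2 * F (rho u)) (4 * K * D)) => {}u w.
have D0 : 0 <= D by rewrite addr_ge0 // mulr_ge0.
have KD := mulr_ge0 K_ge0 D0.
have [uw|/ltW wu] := leP u w.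
  rewrite ger0_norm ?subr_ge0 // => h.
  have -> : p w - p u - -2 * F (rho u) * (w - u) =
    p w - p u + 2 * F (rho u) * (w - u) by ring.
  apply: (le_trans (slope_taylor_le uw h)).
  have -> : 4 * K * D * (w - u) ^+ 2 = 2 * K * D * (w - u) ^+ 2 +
    2 * (K * D * (w - u) ^+ 2) by ring.
  by rewrite lerDl; do 2![apply: mulr_ge0 => //]; exact: sqr_ge0.
rewrite distrC ger0_norm ?subr_ge0 // => h.
have t := slope_taylor_le wu h; have s := F_lip (rho01 w) (rho01 u).
have l := rho_lip_le wu.
have -> : p w - p u - -2 * F (rho u) * (w - u) =
    - (p u - p w + 2 * F (rho w) * (u - w)) -
    2 * ((F (rho u) - F (rho w)) * (u - w)) by ring.
rewrite (le_trans (ler_normB _ _)) // normrN !normrM normr_nat.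
rewrite [`|u - w|]ger0_norm ?subr_ge0 //.
have uw0 : 0 <= u - w by rewrite subr_ge0.
have l' := ler_wpM2l K_ge0 l.
have s' := ler_wpM2r uw0 (le_trans s l').
have -> : 4 * K * D * (w - u) ^+ 2 = 2 * K * D * (u - w) ^+ 2 +
  2 * (K * (D * (u - w)) * (u - w)) by ring.
by rewrite lerD // ler_pM2l.
Qed.

Lemma limit_profile_solution : classical_solution c rho.
Proof.
have d1 : derive1 rho = p.
  by apply/funext => u; rewrite derive1E; apply: derive_val; exact: rho_derive.
have d2 : derive1n 2 rho = fun u => - 2 * F (rho u).
  apply/funext => u; rewrite /derive1n /= d1 derive1E.
  by apply: derive_val; exact: slope_derive.
split.
- move=> u; rewrite /limit_profile.
  suff -> : (fun n => psi n (lattice_floor n (u + 1))) = (fun n => psi n (lattice_floor n u)) by [].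
  apply/funext => n.
  rewrite /lattice_floor mulrDl mul1r floorDrz ?natr_int //.
  by rewrite (_ : N n = (size n).+1%:Z%:~R) // intrKfloor /profile site_period.
- exact: rho01.
- split=> u; first by have [] := rho_derive u.
  by rewrite d1; have [] := slope_derive u.
- rewrite d2; apply: (@lipschitz_continuous _ _ (2 * K * D)) => u w.
  rewrite -mulrBr normrM normrN normr_nat -!mulrA ler_pM2l //.
  rewrite (le_trans (F_lip (rho01 u) (rho01 w))) // ler_wpM2l //.
- by move=> u; rewrite d2; field.
Qed.

Lemma limit_profile_lip u w : `|rho w - rho u| <= D * `|w - u|.
Proof. exact: rho_lip. Qed.

Lemma limit_profile_cvg (x : forall n, 'I_(size n).+1) :
  v (x n) - rho ((x n)%:R / N n) @[n --> U] --> (0 : R).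
Proof.
pose t n : R := (x n)%:R / N n.
have t01 n : 0 <= t n <= 1.
  rewrite /t divr_ge0 //= ler_pdivrMr // mul1r ler_nat ltnW //.
set u := lim (t n @[n --> U]).
have tu : t n @[n --> U] --> u.
  apply: (@ultra_bounded_cvg _ _ _ _ 1) => n.
  by rewrite ger0_norm; case/andP: (t01 n).
have ct n : lattice_floor n (t n) = (x n)%:Z.
  by rewrite /lattice_floor /t divfK ?gt_eqF // -[(x n)%:R]/((x n)%:Z%:~R) intrKfloor.
have close n : `|psi n (lattice_floor n u) - v (x n)| <= D * `|u - t n| + D * (N n)^-1.
  have -> : v (x n) = psi n (lattice_floor n (t n)) by rewrite ct /profile site_nat.
  have D0 : 0 <= D by rewrite addr_ge0 // mulr_ge0.
  wlog : u tu / True => [W|_]; first exact: W.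
  have gen a b : a <= b -> `|psi n (lattice_floor n b) - psi n (lattice_floor n a)| <=
      D * (b - a) + D * (N n)^-1.
    move=> ab; rewrite (cellE n ab).
    apply: (le_trans (profile_diff (@v01 n) F_le (h_le1 n) (small n) _ _)).
    rewrite -mulrDr ler_wpM2l // -lerBlDl.
    exact: le_trans (ler_norm _) (steps_near n ab).
  have [ut|/ltW tu'] := leP u (t n).
    by rewrite distrC [`|u - _|]distrC [`|t n - u|]ger0_norm ?subr_ge0 ?gen.
  by rewrite [`|u - _|]ger0_norm ?subr_ge0 ?gen.
have v_rho : v (x n) @[n --> U] --> rho u.
  have -> : rho u = rho u - 0 by rewrite subr0.
  have -> : (fun n => v (x n)) = (fun n => psi n (lattice_floor n u) -
      (psi n (lattice_floor n u) - v (x n))) by apply/funext => n; rewrite subKr.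
  apply: cvgB; first exact: cvg_psi.
  apply/norm_cvg0P; apply: (@squeeze_cvgr nat U _ R (fun=> 0)
    (fun n => D * `|u - t n| + D * (N n)^-1)).
  - by apply: filterE => n; rewrite normr_ge0 close.
  - exact: cvg_cst.
  - have dt : `|u - t n| @[n --> U] --> (0 : R).
      rewrite -(normr0 R) -(subrr u); apply: (@cvg_norm _ _ nat U).
      by apply: cvgB => //; exact: cvg_cst.
    have -> : 0 = D * 0 + D * 0 :> R by rewrite mulr0 addr0.
    by apply: cvgD; exact: cvgMr.
have rho_t : rho (t n) @[n --> U] --> rho u.
  exact: (continuous_cvg _ (lipschitz_continuous rho_lip (x:=u)) tu).
by rewrite -(subrr (rho u)); exact: cvgB.
Qed.

End lattice_limit.

(** Otherwise almost solutions on finer and finer lattices stay away from all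
    solutions, although their limit along an ultrafilter is one. *)
Lemma almost_solution_close (R : realType) (M : nat) (c : pattern M -> R)
    (B K : R) (delta : R) :
  (forall r : R, 0 <= r <= 1 -> `|reaction c r| <= B) ->
  (forall r s : R, 0 <= r <= 1 -> 0 <= s <= 1 ->
    `|reaction c s - reaction c r| <= K * `|s - r|) ->
  0 <= K -> 0 < delta ->
  exists2 k : R, 0 < k & exists n0 : nat, forall n, (n0 <= n)%N ->
  forall v : 'I_n.+1 -> R, (forall x, 0 <= v x <= 1) ->
  \sum_x `|residual c v x| <= k * n.+1%:R ->
  exists rho : R -> R, [/\ classical_solution c rho,
    forall u w, `|rho w - rho u| <= (2 * B + 2) * `|w - u| &
    forall x : 'I_n.+1, `|v x - rho (x%:R / n.+1%:R)| <= delta].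
Proof.
move=> F_le F_lip K0 delta0; apply: contrapT => no.
pose lat := {n : nat & 'I_n.+1 -> R}.
pose close n (v : 'I_n.+1 -> R) (rho : R -> R) (x : 'I_n.+1) :=
  `|v x - rho (x%:R / n.+1%:R)| <= delta.
pose admissible rho := classical_solution c rho /\
  forall u w, `|rho w - rho u| <= (2 * B + 2) * `|w - u|.
pose bad n (s : lat) := [/\ (n <= projT1 s)%N,
  forall x, 0 <= projT2 s x <= 1,
  \sum_x `|residual c (projT2 s) x| <= harmonic n * (projT1 s).+1%:R &
  forall rho, admissible rho -> exists x, ~ close _ (projT2 s) rho x].
have /choice[s sP] : forall n, exists s, bad n s.
  move=> n; apply: contrapT => nobad; apply: no.
  exists (harmonic n); first by rewrite invr_gt0.
  exists n => m nm v v01 small; apply: contrapT => norho; apply: nobad.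
  exists (existT _ m v); split=> //= rho [cs lip].
  apply: contrapT => allclose; apply: norho; exists rho; split=> // x.
  by apply: contrapT => nx; apply: allclose; exists x.
have [U [UU Uoo]] := ultraFilterLemma eventually_filter.
pose size n := projT1 (s n); pose v n : 'I_(size n).+1 -> R := projT2 (s n).
have size_ge n : (n <= size n)%N by have [] := sP n.
have v01 n x : 0 <= v n x <= 1 by have [_ + _ _] := sP n; exact.
have small n : \sum_x `|residual c (v n) x| <= harmonic n * (size n).+1%:R.
  by have [] := sP n.
pose rho := limit_profile (U := U) (v := v).
have adm : admissible rho.
  split; first exact: (limit_profile_solution F_le F_lip K0 Uoo size_ge v01 small).
  exact: (limit_profile_lip F_le Uoo size_ge v01 small).
have X n : {x | ~ close (size n) (v n) rho x}.
  by apply: cid; have [_ _ _] := sP n; apply.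
have PU : ProperFilter U by exact: ultra_proper.
have := limit_profile_cvg (UU := UU) F_le Uoo size_ge v01 small (fun n => sval (X n)).
move=> /cvgrPdist_le /(_ delta delta0).
move=> /(@filter_ex _ U PU)[n]; rewrite sub0r normrN => cl.
exact: (svalP (X n)).
Qed.

(** * Integrals over finite partitions *)

Section partitions.
Context d (T : measurableType d) (R : realType).
Context (mu : {measure set T -> \bar R}).

Lemma le_bound_integrable (D : set T) (f : T -> R) (C : R) :
  measurable D -> (mu D < +oo)%E -> measurable_fun D f ->
  (forall x, D x -> `|f x| <= C) -> mu.-integrable D (EFin \o f).
Proof.
move=> mD muD mf fC; apply: measurable_bounded_integrable => //.
exists C; split; first exact: num_real.
by move=> c /ltW Cc x Dx; exact: le_trans (fC x Dx) Cc.
Qed.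

Context {I : finType} {F : I -> set T}.
Hypothesis muT : (mu setT <= 1)%E.
Hypothesis mF : forall i, measurable (F i).
Hypothesis coverF : forall u, exists i, F i u.
Hypothesis disjF : forall i j u, F i u -> F j u -> i = j.

Let finT D : measurable D -> (mu D < +oo)%E.
Proof.
move=> mD; apply: le_lt_trans (ltry 1); apply: le_trans muT.
by apply: le_measure; rewrite ?inE.
Qed.

Let Rintegral_cover (G : T -> R) (C : R) : measurable_fun setT G ->
  (forall u, `|G u| <= C) ->
  (\int[mu]_u G u = \sum_i \int[mu]_(u in F i) G u)%R.
Proof.
move=> mG GC.
have iG D : measurable D -> mu.-integrable D (EFin \o G).
  move=> mD; apply: (@le_bound_integrable _ _ C) => //; first exact: finT.
  exact: measurable_funTS.
have cov : \big[setU/set0]_(i <- index_enum I) F i = [set: T].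
  apply/seteqP; split=> // u _; have [i Fi] := coverF u.
  by rewrite -bigcup_seq; exists i => //=; rewrite mem_index_enum.
rewrite /Rintegral -cov integral_bigsetU_EFin //.
- rewrite sum_fine // => i _; exact: (integrable_fin_num (mF i) (iG _ (mF i))).
- exact: index_enum_uniq.
- by move=> i j _ _ [u [Fi Fj]]; exact: disjF Fi Fj.
- by rewrite cov; apply/measurable_EFinP.
Qed.

Lemma sum_partition : \sum_i fine (mu (F i)) = fine (mu setT).
Proof.
have /= := Rintegral_cover (G := fun=> 1) (C := 1) (measurable_cst _)
  (fun u => ltac:(by rewrite normr1)).
rewrite Rintegral_cst // mul1r => ->.
by apply: eq_bigr => i _; rewrite Rintegral_cst // mul1r.
Qed.

(** Used with the cells of the torus and, with [e = 0], with the atoms of a finite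
    space. *)
Lemma Rintegral_partition (G : T -> R) (g : I -> R) (C e : R) :
  measurable_fun setT G -> (forall u, `|G u| <= C) -> 0 <= e ->
  (forall i u, F i u -> `|G u - g i| <= e) ->
  `|(\int[mu]_u G u)%R - \sum_i g i * fine (mu (F i))| <= e.
Proof.
move=> mG GC e0 Ge; rewrite (Rintegral_cover mG GC) -sumrB.
rewrite (le_trans (ler_norm_sum _ _ _)) //.
apply: (@le_trans _ _ (\sum_i e * fine (mu (F i)))).
  apply: ler_sum => i _.
  have icst a : mu.-integrable (F i) (EFin \o (fun=> a : R)).
    apply: (@le_bound_integrable _ _ `|a|) => //; exact: finT.
  have iG : mu.-integrable (F i) (EFin \o G).
    apply: (@le_bound_integrable _ _ C) => //; first exact: finT.
    exact: measurable_funTS.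
  rewrite ler_norml; apply/andP; split.
    rewrite lerBrDr -mulNr -mulrDl -Rintegral_cst //.
    apply: le_Rintegral => // u Fu; have := Ge i u Fu.
    by rewrite ler_norml => /andP[h _]; lra.
  rewrite lerBlDr -mulrDl -Rintegral_cst //.
  apply: le_Rintegral => // u Fu; have := Ge i u Fu.
  by rewrite ler_norml => /andP[_ h]; lra.
rewrite -mulr_sumr sum_partition ler_piMr // -lee_fin fineK //.
by rewrite ge0_fin_numE // finT.
Qed.

End partitions.

(** * Measures on the torus *)

Section torus_cells.
Context {R : realType} {N : nat}.

Lemma measurable_torus_val : measurable_fun setT (@torus_val R).
Proof. by move=> _ B mB; exists B. Qed.

Definition torus_cell (x : 'I_N) : set (torus R) :=
  (@torus_val R) @^-1` `[x%:R / N%:R, x.+1%:R / N%:R[.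

Lemma torus_cell_measurable x : measurable (torus_cell x).
Proof. rewrite -[torus_cell x]setTI; exact: measurable_torus_val. Qed.

Hypothesis N_gt0 : (0 < N)%N.

Let N0 : 0 < N%:R :> R. Proof. by rewrite ltr0n. Qed.

Lemma torus_cellP x (u : torus R) : torus_cell x u <->
  x%:R <= \val u * N%:R < x.+1%:R.
Proof.
rewrite /torus_cell /= in_itv /= /torus_val.
by rewrite ler_pdivrMr // ltr_pdivlMr.
Qed.

Lemma torus_cell_cover u : exists x, torus_cell x u.
Proof.
have /andP[u0 u1] := valP u.
have t0 : 0 <= \val u * N%:R by rewrite mulr_ge0.
have /andP[l1 l2] := truncn_itv t0.
have tN : (Num.truncn (\val u * N%:R) < N)%N.
  by rewrite -(ltr_nat R) (le_lt_trans l1) // gtr_pMl.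
by exists (Ordinal tN); apply/torus_cellP; rewrite l1 l2.
Qed.

Lemma torus_cell_disjoint x y u : torus_cell x u -> torus_cell y u -> x = y.
Proof.
move=> /torus_cellP/andP[x1 x2] /torus_cellP/andP[y1 y2]; apply: val_inj.
have xy : (x < y.+1)%N by rewrite -(ltr_nat R) (le_lt_trans x1).
have yx : (y < x.+1)%N by rewrite -(ltr_nat R) (le_lt_trans y1).
by apply/eqP; rewrite eqn_leq -ltnS xy -ltnS yx.
Qed.

Lemma torus_cell_dist x (u : torus R) : torus_cell x u ->
  `|\val u - x%:R / N%:R| <= N%:R^-1.
Proof.
move=> /torus_cellP/andP[x1 x2].
have -> : \val u - x%:R / N%:R = (\val u * N%:R - x%:R) / N%:R.
  by field; rewrite gt_eqF.
rewrite normrM [`|N%:R^-1|]gtr0_norm ?invr_gt0 //.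
apply: ler_piMl; first by rewrite invr_ge0.
rewrite ger0_norm ?subr_ge0 // lerBlDr -[1]/(1%:R) -natrD add1n; exact: ltW.
Qed.

Lemma torus_cell_image x : (@torus_val R) @` torus_cell x =
  `[x%:R / N%:R, x.+1%:R / N%:R[%classic.
Proof.
apply/seteqP; split=> [_ [u cu <-] //|a ax].
have a01 : 0 <= a < 1.
  move: ax; rewrite /= in_itv /= => /andP[a0 a1].
  rewrite (le_trans _ a0) ?divr_ge0 //= (lt_le_trans a1) //.
  by rewrite ler_pdivrMr // mul1r ler_nat.
by exists (exist _ a a01).
Qed.

Lemma empirical_cell (eta : config N) x :
  fine (@empirical R N eta (torus_cell x)) = (eta x)%:R / N%:R.
Proof.
have -> : @empirical R N eta (torus_cell x) = (N%:R^-1%:E *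
    \sum_(y < N) (eta y)%:R%:E * dirac (torus_site R y) (torus_cell x))%E by [].
rewrite (bigD1 x) //= big1 ?adde0 => [|y yx].
  rewrite diracE mem_set ?mule1 -?EFinM ?[_^-1 * _]mulrC //.
  by apply/torus_cellP; rewrite /= divfK ?gt_eqF // lexx ltr_nat ltnSn.
rewrite diracE memNset ?mule0 //; apply: contraNnot yx => yx.
apply/eqP; apply: (torus_cell_disjoint _ yx).
by apply/torus_cellP; rewrite /= divfK ?gt_eqF // lexx ltr_nat ltnSn.
Qed.

End torus_cells.

Section density.
Context {R : realType} {rho : R -> R}.
Hypothesis rho_cont : continuous rho.
Hypothesis rho01 : forall u, 0 <= rho u <= 1.

Let leb : {measure set (measurableTypeR R) -> \bar R} := @lebesgue_measure R.

Definition density_fun (A : set (torus R)) : \bar R :=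
  (\int[leb]_(u in (@torus_val R) @` A) (rho u)%:E)%E.

Let rho_ge0 (D : set (measurableTypeR R)) (u : R) : D u -> (0 <= (rho u)%:E)%E.
Proof. by rewrite lee_fin; case/andP: (rho01 u). Qed.

Let rho_meas (D : set (measurableTypeR R)) : measurable_fun D (EFin \o rho).
Proof.
apply: measurable_funTS; apply/measurable_EFinP.
exact: continuous_measurable_fun.
Qed.

Let image_meas (A : set (torus R)) : measurable A ->
  measurable ((@torus_val R) @` A).
Proof.
move=> [B mB <-].
have -> : (@torus_val R) @` (setT `&` (@torus_val R) @^-1` B) =
    B `&` `[0, 1[%classic.
  apply/seteqP; split=> [_ [u [_ Bu] <-]|a [Ba]].
    by split=> //; rewrite /= in_itv; exact: (valP u).
  by rewrite /= in_itv /= => a01; exists (exist _ a a01).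
by apply: measurableI => //; exact: measurable_itv.
Qed.

Let density0 : density_fun set0 = 0%E.
Proof. by rewrite /density_fun image_set0 integral_set0. Qed.

Let density_ge0 A : (0 <= density_fun A)%E.
Proof. by apply: integral_ge0 => u; exact: rho_ge0. Qed.

Let density_sigma_additive : semi_sigma_additive density_fun.
Proof.
move=> F mF tF mUF; rewrite /density_fun; apply: cvg_toP.
  apply: ereal_nondecreasing_is_cvgn => m n mn.
  by apply: lee_sum_nneg_natr => // k _ _; apply: integral_ge0 => u; exact: rho_ge0.
rewrite image_bigcup ge0_integral_bigcup //.
- by move=> k; exact: image_meas.
- by move=> u; exact: rho_ge0.
- move=> i j _ _ [_ [[u Fu <-] [w Fw /val_inj wu]]]; rewrite wu in Fw.
  by apply: tF => //; exists u.
Qed.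

HB.instance Definition _ := isMeasure.Build _ _ _ density_fun
  density0 density_ge0 density_sigma_additive.

Let density_setT : (density_fun [set: torus R] <= 1)%E.
Proof.
rewrite /density_fun.
have -> : (@torus_val R) @` [set: torus R] = `[0, 1[%classic.
  apply/seteqP; split=> [_ [u _ <-]|a]; first by rewrite /= in_itv; exact: (valP u).
  by rewrite /= in_itv /= => a01; exists (exist _ a a01).
apply: (@le_trans _ _ (\int[leb]_(u in `[0%R, 1%R[) (cst 1 u))%E).
  apply: ge0_le_integral => //.
    by move=> u; exact: rho_ge0.
  by move=> u _; rewrite lee_fin; case/andP: (rho01 u).
rewrite integral_cst // mul1e.
change (@lebesgue_measure R `[0%R, 1%R[%classic <= 1)%E.
by rewrite lebesgue_measure_itv /= lte_fin ltr01 oppr0 adde0.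
Qed.

HB.instance Definition _ :=
  Measure_isSubProbability.Build _ _ _ density_fun density_setT.

Definition density : subprob_torus R := density_fun.

Lemma density_has_density : has_density density rho.
Proof. by []. Qed.

Lemma density_cell (N : nat) (L : R) (x : 'I_N) : (0 < N)%N -> 0 <= L ->
  (forall u w, `|rho w - rho u| <= L * `|w - u|) ->
  `|fine (density (torus_cell x)) - rho (x%:R / N%:R) / N%:R| <=
  L / N%:R / N%:R.
Proof.
move=> N_gt0 L0 lip; have N0 : 0 < N%:R :> R by rewrite ltr0n.
set a : R := x%:R / N%:R.
have -> : density (torus_cell x) =
    (\int[leb]_(u in (@torus_val R) @` torus_cell x) (rho u)%:E)%E by [].
rewrite torus_cell_image // -/a.
set D := `[a, _[%classic.
have mD : measurable (D : set (measurableTypeR R)) by exact: measurable_itv.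
have lD : leb D = (N%:R^-1)%:E.
  change (@lebesgue_measure R D = (N%:R^-1)%:E).
  rewrite lebesgue_measure_itv /= lte_fin /a ltr_pM2r ?invr_gt0 //.
  rewrite ltr_nat ltnSn -EFinB -mulrBl -[x.+1]addn1 natrD addrAC subrr add0r.
  by rewrite mul1r.
have icst (b : R) : leb.-integrable D (EFin \o (fun=> b)).
  by apply: (@le_bound_integrable _ _ _ _ _ _ `|b|) => //; rewrite lD ltry.
have ir : leb.-integrable D (EFin \o rho).
  apply: (@le_bound_integrable _ _ _ _ _ _ 1) => //; first by rewrite lD ltry.
    by apply/measurable_EFinP; exact: rho_meas.
  by move=> u _; rewrite ger0_norm; case/andP: (rho01 u).
have close u : D u -> `|rho u - rho a| <= L / N%:R.
  rewrite /D /= in_itv /= => /andP[au ub].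
  rewrite (le_trans (lip _ _)) // ler_wpM2l // ger0_norm ?subr_ge0 //.
  rewrite lerBlDr (le_trans (ltW ub)) // /a -[x.+1]addn1 natrD mulrDl mul1r.
  by rewrite addrC.
have cst (b : R) : (\int[leb]_(u in D) b)%R = b / N%:R.
  by rewrite Rintegral_cst // lD.
rewrite ler_norml; apply/andP; split.
  rewrite lerBrDr -mulNr -mulrDl -(cst (- (L / N%:R) + rho a)).
  apply: le_Rintegral => // u Du; have := close u Du.
  by rewrite ler_norml => /andP[h _]; lra.
rewrite lerBlDr -mulrDl -(cst (L / N%:R + rho a)).
apply: le_Rintegral => // u Du; have := close u Du.
by rewrite ler_norml => /andP[_ h]; lra.
Qed.

End density.

(** * The distance between the empirical measure and a profile *)

Section waves.
Context {R : realType}.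

Definition wave (k : nat) (a : R) : R :=
  if odd k then sin (2 * pi * (k./2)%:R * a) else cos (2 * pi * (k./2)%:R * a).

Lemma trigE k (u : torus R) : trig k u = wave k (\val u).
Proof. by []. Qed.

Lemma wave_le1 k a : `|wave k a| <= 1.
Proof. by rewrite /wave; case: ifP => _; [exact: sin_max|exact: cos_max]. Qed.

Let lip1 (f df : R -> R) : (forall x : R, is_derive x (1 : R) f (df x)) ->
  (forall x, `|df x| <= 1) -> forall a b, `|f b - f a| <= `|b - a|.
Proof.
move=> fdf df1 a b; wlog ab : a b / a <= b => [W|].
  have [|/ltW ba] := leP a b; first exact: W.
  by rewrite distrC [`|b - a|]distrC; exact: W.
have fc : {within `[a, b], continuous f}.
  by apply: derivable_within_continuous => x _; have [] := fdf x.
have [x xab ->] := @MVT_segment R f df a b ab (fun x _ => fdf x) fc.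
by rewrite normrM ler_piMl.
Qed.

Lemma wave_lip k a b :
  `|wave k b - wave k a| <= 2 * pi * (k./2)%:R * `|b - a|.
Proof.
have w0 : 0 <= 2 * pi * (k./2)%:R :> R by rewrite !mulr_ge0 ?pi_ge0.
rewrite -[X in X * _](ger0_norm w0) -normrM mulrBr /wave; case: ifP => _.
  by apply: (lip1 (df := cos)) => // x; exact: cos_max.
apply: (lip1 (df := fun x => - sin x)) => // x; rewrite normrN; exact: sin_max.
Qed.

Lemma wave_period k a : wave k (a + 1) = wave k a.
Proof.
have E : 2 * pi * (k./2)%:R * (a + 1) =
    2 * pi * (k./2)%:R * a + pi *+ 2 *+ k./2 :> R.
  by rewrite -[pi *+ 2 *+ _]mulr_natr -[pi *+ 2]mulr_natl; ring.
rewrite /wave E; case: ifP => _; first by rewrite (periodicn (@sinD2pi R)).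
by rewrite (periodicn (@cosD2pi R)).
Qed.

Lemma wave_meas k : measurable_fun setT (@trig R k).
Proof.
have mw : measurable_fun setT (wave k : measurableTypeR R -> measurableTypeR R).
  apply: continuous_measurable_fun.
  exact: (lipschitz_continuous (@wave_lip k)).
exact: (measurableT_comp mw (@measurable_torus_val R)).
Qed.

End waves.

Section smoothing.
Context {R : realType} {N l : nat} {t : 'I_N -> R} {w : R}.
Hypothesis l_gt0 : (0 < l)%N.
Hypothesis w_ge0 : 0 <= w.
Hypothesis t_diff : forall x, `|t (ordS x) - t x| <= w.

Let t_sh x i : `|t (sh x i) - t x| <= i%:R * w.
Proof.
elim: i => [|i IH]; first by rewrite subrr normr0 mul0r.
rewrite shS (le_trans (ler_distD (t (sh x i)) _ _)) //.
by rewrite -[i.+1]add1n natrD mulrDl mul1r lerD.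
Qed.

(** Summation by parts moves the translations onto the test function. *)
Lemma box_test (v : 'I_N -> R) : (forall x, `|v x| <= 1) ->
  `|\sum_x (v x - box l v x) * t x| <= N%:R * (l%:R * w).
Proof.
move=> v1; have l0 : 0 < l%:R :> R by rewrite ltr0n.
have -> : \sum_x (v x - box l v x) * t x = l%:R^-1 *
    \sum_(i < l) \sum_x v (sh x i) * (t (sh x i) - t x).
  under [in RHS]eq_bigr => i _.
    under eq_bigr do rewrite mulrBr.
    rewrite sumrB (sum_sh i (fun x => v x * t x)).
    over.
  have cancel_l (q : R) : l%:R^-1 * (q *+ l) = q.
    by rewrite -[q *+ l]mulr_natl mulKf // gt_eqF.
  rewrite sumrB sumr_const card_ord mulrBr cancel_l.
  under eq_bigr do rewrite mulrBl.
  rewrite sumrB; congr (_ - _); rewrite exchange_big /= mulr_sumr.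
  by apply: eq_bigr => x _; rewrite /box -mulrA mulr_suml.
rewrite normrM gtr0_norm ?invr_gt0 // ler_pdivrMl //.
rewrite (le_trans (ler_norm_sum _ _ _)) //.
apply: (@le_trans _ _ (\sum_(i < l) N%:R * (l%:R * w))); last first.
  by rewrite sumr_const card_ord -[leLHS]mulr_natl.
apply: ler_sum => i _; rewrite (le_trans (ler_norm_sum _ _ _)) //.
apply: (@le_trans _ _ (\sum_(x < N) l%:R * w)); last first.
  by rewrite sumr_const card_ord -[leLHS]mulr_natl.
apply: ler_sum => x _; rewrite normrM.
apply: (@le_trans _ _ (1 * (i%:R * w))); first exact: ler_pM.
by rewrite mul1r ler_wpM2r // ler_nat ltnW.
Qed.

Lemma box3_test (v : 'I_N -> R) : (forall x, `|v x| <= 1) ->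
  `|\sum_x (v x - box3 l v x) * t x| <= 3 * (N%:R * (l%:R * w)).
Proof.
move=> v1; have v2 : forall x, `|box l v x| <= 1 by exact: box_norm.
have v3 : forall x, `|box l (box l v) x| <= 1 by exact: box_norm.
have -> : \sum_x (v x - box3 l v x) * t x =
    \sum_x (v x - box l v x) * t x +
    (\sum_x (box l v x - box l (box l v) x) * t x +
     \sum_x (box l (box l v) x - box l (box l (box l v)) x) * t x).
  by rewrite -!big_split; apply: eq_bigr => x _; rewrite /box3 /=; ring.
have h1 := box_test v1; have h2 := box_test v2; have h3 := box_test v3.
rewrite (le_trans (ler_normD _ _)) // (le_trans (lerD h1 (ler_normD _ _))) //.
by rewrite (le_trans (lerD (lexx _) (lerD h2 h3))) //; lra.
Qed.

End smoothing.

Section distance.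
Context {R : realType} {N l : nat} {eta : config N} {rho : R -> R} {L delta : R}.
Hypothesis N_gt0 : (0 < N)%N.
Hypothesis l_gt0 : (0 < l)%N.
Hypothesis rho_cont : continuous rho.
Hypothesis rho01 : forall u, 0 <= rho u <= 1.
Hypothesis L_ge0 : 0 <= L.
Hypothesis delta_ge0 : 0 <= delta.
Hypothesis rho_lip : forall u w, `|rho w - rho u| <= L * `|w - u|.
Hypothesis close : forall x : 'I_N, `|field l eta x - rho (x%:R / N%:R)| <= delta.

Let N0 : 0 < N%:R :> R. Proof. by rewrite ltr0n. Qed.

Let dens := density rho_cont rho01.

Let pairing_cells (mu : subprob_torus R) k :
  `|pairing mu (trig k) - \sum_(x < N) wave k (x%:R / N%:R) *
     fine (mu (torus_cell x))| <= 2 * pi * (k./2)%:R / N%:R.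
Proof.
apply: (@Rintegral_partition _ _ R mu 'I_N _ _ _ _ _ (trig k) _ 1).
- exact: sprobability_setT.
- exact: torus_cell_measurable.
- exact: torus_cell_cover.
- by move=> x y u; exact: torus_cell_disjoint.
- exact: wave_meas.
- by move=> u; exact: wave_le1.
- by rewrite !mulr_ge0 ?pi_ge0 ?invr_ge0.
- move=> x u xu; rewrite trigE (le_trans (wave_lip _ _ _)) //.
  rewrite ler_wpM2l ?mulr_ge0 ?pi_ge0 //; exact: torus_cell_dist.
Qed.

Let wave_step k (x : 'I_N) :
  `|wave k ((ordS x)%:R / N%:R) - wave k (x%:R / N%:R)| <=
  2 * pi * (k./2)%:R / N%:R :> R.
Proof.
have -> : wave k ((ordS x)%:R / N%:R) = wave k (x.+1%:R / N%:R) :> R.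
  rewrite /=; have [xN|] := ltnP x.+1 N; first by rewrite modn_small.
  move=> Nx; have -> : x.+1 = N by apply/eqP; rewrite eqn_leq Nx ltn_ord.
  by rewrite modnn mul0r divff ?gt_eqF // -[1]add0r wave_period.
rewrite (le_trans (wave_lip _ _ _)) // ler_wpM2l ?mulr_ge0 ?pi_ge0 //.
rewrite -mulrBl -[x.+1]addn1 natrD addrAC subrr add0r mul1r.
by rewrite ger0_norm // invr_ge0.
Qed.

(** Both integrals are Riemann sums over the cells of the lattice up to the
    oscillation of the wave in a cell; the sums are compared through the field,
    which costs the oscillation of the wave at the scale [3 l] of the averages. *)
Lemma pairing_dist k :
  `|pairing (@empirical R N eta) (trig k) - pairing dens (trig k)| <=
  (L / N%:R + delta) + 2 * pi * (2 + 3 * l%:R) / N%:R * k%:R.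
Proof.
pose t (x : 'I_N) : R := wave k (x%:R / N%:R).
set w : R := 2 * pi * (k./2)%:R.
have w_ge0 : 0 <= w by rewrite !mulr_ge0 ?pi_ge0.
have h1 := pairing_cells (@empirical R N eta) k.
have h2 := pairing_cells dens k.
have t1 x : `|t x| <= 1 by exact: wave_le1.
have h3 : `|\sum_x t x * fine (dens (torus_cell x)) -
    \sum_x t x * (rho (x%:R / N%:R) / N%:R)| <= L / N%:R.
  rewrite -sumrB (le_trans (ler_norm_sum _ _ _)) //.
  have -> : L / N%:R = \sum_(x < N) L / N%:R / N%:R.
    by rewrite sumr_const card_ord -[RHS]mulr_natl; field; rewrite gt_eqF.
  apply: ler_sum => x _; rewrite -mulrBr normrM -[leRHS]mul1r.
  by apply: ler_pM => //; exact: density_cell.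
have h4 : `|\sum_x t x * (field l eta x / N%:R) -
    \sum_x t x * (rho (x%:R / N%:R) / N%:R)| <= delta.
  rewrite -sumrB (le_trans (ler_norm_sum _ _ _)) //.
  have -> : delta = \sum_(x < N) delta / N%:R.
    by rewrite sumr_const card_ord -[RHS]mulr_natl; field; rewrite gt_eqF.
  apply: ler_sum => x _; rewrite -mulrBr -mulrBl normrM -[leRHS]mul1r.
  apply: ler_pM => //; rewrite normrM [`|N%:R^-1|]ger0_norm ?invr_ge0 //.
  by rewrite ler_wpM2r ?invr_ge0.
have h5 : `|\sum_x t x * ((eta x)%:R / N%:R) -
    \sum_x t x * (field l eta x / N%:R)| <= 3 * (l%:R * (w / N%:R)).
  have -> : \sum_x t x * ((eta x)%:R / N%:R) - \sum_x t x * (field l eta x / N%:R) =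
      N%:R^-1 * \sum_x ((eta x)%:R - field l eta x) * t x.
    by rewrite -sumrB mulr_sumr; apply: eq_bigr => x _; ring.
  have e1 x : `|(eta x)%:R| <= 1 :> R by case: (eta x); rewrite ?normr1 ?normr0.
  have wN : 0 <= w / N%:R by rewrite divr_ge0.
  have := box3_test l_gt0 wN (wave_step k) e1.
  rewrite normrM gtr0_norm ?invr_gt0 // ler_pdivrMl // => /le_trans; apply.
  by rewrite le_eqVlt; apply/orP; left; apply/eqP; ring.
have emp : \sum_(x < N) wave k (x%:R / N%:R) *
    fine (@empirical R N eta (torus_cell x)) = \sum_x t x * ((eta x)%:R / N%:R).
  by apply: eq_bigr => x _; rewrite empirical_cell.
rewrite emp in h1.
have h6 : w <= 2 * pi * k%:R.
  by rewrite ler_wpM2l ?mulr_ge0 ?pi_ge0 // ler_nat; lia.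
have h7 : (2 + 3 * l%:R) / N%:R * w <= 2 * pi * (2 + 3 * l%:R) / N%:R * k%:R.
  have -> : 2 * pi * (2 + 3 * l%:R) / N%:R * k%:R =
    (2 + 3 * l%:R) / N%:R * (2 * pi * k%:R) :> R by ring.
  by rewrite ler_wpM2l // divr_ge0 // addr_ge0 // mulr_ge0.
have h8 : (2 + 3 * l%:R) / N%:R * w = 2 * (w / N%:R) + 3 * (l%:R * (w / N%:R)).
  by ring.
rewrite -/w in h1 h2.
set p1 := pairing _ _ in h1 *; set p2 := pairing _ _ in h2 *.
move: h1 h2 h3 h4 h5; rewrite /t !ler_norml.
set s1 := \sum_x _; set s2 := \sum_x _; set s3 := \sum_x _; set s4 := \sum_x _.
move=> /andP[? ?] /andP[? ?] /andP[? ?] /andP[? ?] /andP[? ?].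
apply/andP; split; lra.
Qed.

Let geometric (a b : R) n : 0 <= a -> 0 <= b ->
  \sum_(0 <= k < n) (2 ^+ k)^-1 * (a + b * k%:R) <= 2 * a + 2 * b.
Proof.
move=> a0 b0; suff : \sum_(0 <= k < n) (2 ^+ k)^-1 * (a + b * k%:R) =
    2 * a + 2 * b - (2 ^+ n)^-1 * (2 * a + 2 * b + 2 * b * n%:R).
  by move=> ->; rewrite gerBl mulr_ge0 ?invr_ge0 ?exprn_ge0 // !addr_ge0 // ?mulr_ge0.
elim: n => [|n IH].
  by rewrite big_geq // expr0 invr1; ring.
rewrite big_nat_recr //= IH exprS -[n.+1]addn1 natrD; field.
by rewrite expf_neq0.
Qed.

Lemma dist_le : (dist (@empirical R N eta) dens <=
  (2 * (L / N%:R + delta) + 2 * (2 * pi * (2 + 3 * l%:R) / N%:R))%:E)%E.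
Proof.
apply: lime_le; first by apply: is_cvg_nneseries => k _ _;
  rewrite lee_fin mulr_ge0 ?invr_ge0 ?exprn_ge0.
apply: nearW => n; rewrite sumEFin lee_fin.
apply: le_trans (geometric n _ _); last first.
- by rewrite divr_ge0 ?mulr_ge0 ?pi_ge0 ?addr_ge0 ?mulr_ge0.
- by rewrite addr_ge0 // divr_ge0.
apply: ler_sum => k _; rewrite ler_wpM2l ?invr_ge0 ?exprn_ge0 //.
exact: pairing_dist.
Qed.

End distance.

(** * Stationarity *)

Section finite_integrals.
Context {R : realType} {N : nat} (mu : probability (config N) R).

Definition mass (eta : config N) : R := fine (mu [set eta]).

Let mu_le1 : (mu setT <= 1)%E. Proof. by rewrite probability_setT. Qed.

Lemma mass_ge0 eta : 0 <= mass eta.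
Proof. exact: fine_ge0. Qed.

Lemma mass_sum : \sum_eta mass eta = 1.
Proof.
have -> : 1 = fine (mu setT) by rewrite probability_setT.
apply: (@sum_partition _ _ R mu (config N) (fun eta => [set eta])) => //.
- by move=> u; exists u.
- by move=> i j u /= -> ->.
Qed.

Lemma integral_mass (f : config N -> R) :
  (\int[mu]_eta f eta)%R = \sum_eta mass eta * f eta.
Proof.
apply/eqP; rewrite -subr_eq0 -normr_le0.
under eq_bigr do rewrite mulrC.
apply: (@Rintegral_partition _ _ R mu (config N) (fun eta => [set eta])
  _ _ _ _ f f (\sum_eta `|f eta|)) => //.
- by move=> u; exists u.
- by move=> i j u /= -> ->.
- by move=> u; rewrite (bigD1 u) //= lerDl sumr_ge0.
- by move=> i u /= ->; rewrite subrr normr0.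
Qed.

Lemma markov_mass (A : set (config N)) (h : config N -> R) :
  (forall eta, 0 <= h eta) -> (forall eta, A eta -> 1 <= h eta) ->
  fine (mu A) <= \sum_eta mass eta * h eta.
Proof.
move=> h0 h1.
have -> : mu A = (\int[mu]_eta (\1_A eta)%:E)%E.
  by rewrite integral_indic // setIT.
rewrite -[fine _]/(\int[mu]_eta (\1_A eta : R))%R integral_mass.
apply: ler_sum => eta _; rewrite ler_wpM2l ?mass_ge0 // indicE.
by case: (asboolP (A eta)) => [Ae|nAe]; [rewrite mem_set ?h1|rewrite memNset].
Qed.

End finite_integrals.

Section stationarity.
Context {R : realType} {M N : nat} {c : pattern M -> R} {C : R}.
Hypothesis c_bnd : forall xi, 0 <= c xi <= C.

Let C_ge0 : 0 <= C.
Proof. by have /andP[/le_trans h /h] := c_bnd [ffun=> false]. Qed.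

Let rate : R := N%:R ^+ 2 * N%:R + N%:R * (C * 2).

Let rate_ge0 : 0 <= rate.
Proof. by rewrite addr_ge0 ?mulr_ge0 ?exprn_ge0. Qed.

Lemma generator_norm (f : config N -> R) (a : R) : (forall eta, `|f eta| <= a) ->
  forall eta, `|generator c f eta| <= rate * a.
Proof.
move=> fa eta.
have d eta' : `|f eta' - f eta| <= 2 * a.
  by have := ler_normB (f eta') (f eta); have := fa eta; have := fa eta'; lra.
rewrite /generator (le_trans (ler_normD _ _)) // /rate mulrDl; apply: lerD.
  rewrite normrM ger0_norm ?divr_ge0 ?exprn_ge0 //.
  have -> : N%:R ^+ 2 * N%:R * a = N%:R ^+ 2 / 2 * (N%:R * (2 * a)) by field.
  rewrite ler_wpM2l ?divr_ge0 ?exprn_ge0 // (le_trans (ler_norm_sum _ _ _)) //.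
  rewrite mulr_natl -[X in _ *+ X](card_ord N) -sumr_const; exact: ler_sum.
rewrite (le_trans (ler_norm_sum _ _ _)) //.
have -> : N%:R * (C * 2) * a = \sum_(x < N) C * (2 * a).
  by rewrite sumr_const card_ord -[RHS]mulr_natl; ring.
apply: ler_sum => x _; rewrite normrM.
have /andP[c0 cC] := c_bnd (window M x eta).
by apply: ler_pM => //; rewrite ger0_norm.
Qed.

Lemma iter_generator_norm (f : config N -> R) (a : R) n :
  (forall eta, `|f eta| <= a) ->
  forall eta, `|iter n (generator c (N:=N)) f eta| <= rate ^+ n * a.
Proof.
move=> fa; elim: n => [|n IH] eta; first by rewrite expr0 mul1r.
by rewrite iterS exprS -mulrA; exact: generator_norm.
Qed.

(** The terms of the exponential series from the second one on carry a factor
    [t ^+ 2]. *)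
Lemma semigroup_taylor (f : config N -> R) (a t : R) (eta : config N) :
  (forall eta, `|f eta| <= a) -> 0 <= t <= 1 ->
  `|semigroup c t f eta - f eta - t * generator c f eta| <=
  t ^+ 2 * (a * expR rate).
Proof.
move=> fa /andP[t0 t1].
have a0 : 0 <= a by exact: le_trans (fa eta).
pose u n := exp_coeff t n * iter n (generator c (N:=N)) f eta.
have uE n : `|u n| <= exp_coeff (t * rate) n * a.
  rewrite /u /exp_coeff /= normrM exprMn.
  rewrite [`|_ / _|]ger0_norm ?divr_ge0 ?exprn_ge0 //.
  have -> : t ^+ n * rate ^+ n / n`!%:R * a = t ^+ n / n`!%:R * (rate ^+ n * a).
    by ring.
  by rewrite ler_wpM2l ?divr_ge0 ?exprn_ge0 // iter_generator_norm.
have cu : cvgn (series u).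
  apply: normed_cvg; apply: (@series_le_cvg _ _ (a *: exp_coeff (t * rate))).
  - by move=> n; exact: normr_ge0.
  - by move=> n; rewrite mulr_ge0 // exp_coeff_ge0 // mulr_ge0.
  - by move=> n; have := uE n; rewrite mulrC.
  - by apply: is_cvg_seriesZ; exact: is_cvg_series_exp_coeff.
have partial n : `|series u n.+2 - f eta - t * generator c f eta| <=
    t ^+ 2 * (a * expR rate).
  have -> : series u n.+2 - f eta - t * generator c f eta =
      \sum_(2 <= k < n.+2) u k.
    rewrite /series /= (big_cat_nat (n := 2)) //= big_nat_recr //= big_nat1.
    by rewrite /u /exp_coeff /= !expr0 expr1 fact0 divr1 !mul1r divr1; ring.
  rewrite (le_trans (ler_norm_sum _ _ _)) //.
  apply: (@le_trans _ _ (\sum_(2 <= k < n.+2) t ^+ 2 * (a * exp_coeff rate k))).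
    rewrite big_nat [leRHS]big_nat; apply: ler_sum => k /andP[k2 _].
    rewrite (le_trans (uE k)) // /exp_coeff /= exprMn.
    have -> : t ^+ 2 * (a * (rate ^+ k / k`!%:R)) =
      t ^+ 2 * (rate ^+ k / k`!%:R * a) by ring.
    have -> : t ^+ k * rate ^+ k / k`!%:R * a =
      t ^+ k * (rate ^+ k / k`!%:R * a) by ring.
    apply: ler_wpM2r.
      by rewrite !mulr_ge0 ?exprn_ge0 ?invr_ge0.
    by rewrite -(subnKC k2) exprD ler_piMr ?exprn_ge0 // exprn_ile1.
  rewrite -mulr_sumr; apply: ler_wpM2l; first by rewrite exprn_ge0.
  rewrite -mulr_sumr; apply: ler_wpM2l => //.
  have nd : {homo series (exp_coeff rate) : m n / (m <= n)%N >-> m <= n}.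
    by apply: nondecreasing_series => k _ _; exact: exp_coeff_ge0.
  apply: le_trans (nondecreasing_cvgn_le nd (is_cvg_series_exp_coeff rate) n.+2).
  rewrite /series /= [leRHS](big_cat_nat (n := 2)) //= lerDr.
  by apply: sumr_ge0 => k _; exact: exp_coeff_ge0.
have lim_u : `|series u n - f eta - t * generator c f eta| @[n --> \oo] -->
    `|limn (series u) - f eta - t * generator c f eta|.
  by apply: cvg_norm; apply: cvgB; [apply: cvgB => //|]; exact: cvg_cst.
apply: (cvgr_to_le lim_u); near=> n.
have n2 : (2 <= n)%N by near: n; exact: nbhs_infty_ge.
have -> : n = (n - 2).+2 by rewrite -addn2 subnK.
exact: partial.
Unshelve. all: by end_near.
Qed.

(** The derivative at time 0 of a constant mean. *)
Lemma invariant_stationary (mu : probability (config N) R) :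
  invariant_measure c mu ->
  forall f : config N -> R, \sum_eta mass mu eta * generator c f eta = 0.
Proof.
move=> inv f; set s := \sum_eta _.
pose a := \sum_eta `|f eta|.
have fa eta : `|f eta| <= a by rewrite /a (bigD1 eta) //= lerDl sumr_ge0.
have bound t : 0 < t -> t <= 1 -> `|s| <= t * (a * expR rate).
  move=> t0 t1; have t01 : 0 <= t <= 1 by rewrite ltW.
  have E : t * s = - \sum_eta mass mu eta *
      (semigroup c t f eta - f eta - t * generator c f eta).
    have := inv t f (ltW t0); rewrite !integral_mass => I.
    under eq_bigr do rewrite !mulrBr.
    rewrite !sumrB I subrr sub0r opprK /s mulr_sumr.
    by apply: eq_bigr => eta _; rewrite mulrCA.
  rewrite -(ler_pM2l t0) -{1}(ger0_norm (ltW t0)) -normrM E normrN.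
  rewrite (le_trans (ler_norm_sum _ _ _)) //.
  have -> : t * (t * (a * expR rate)) =
      \sum_eta mass mu eta * (t ^+ 2 * (a * expR rate)).
    by rewrite -mulr_suml mass_sum mul1r; ring.
  apply: ler_sum => eta _; rewrite normrM ger0_norm ?mass_ge0 //.
  by rewrite ler_wpM2l ?mass_ge0 // semigroup_taylor.
apply/eqP; rewrite -normr_le0; apply/ler_addgt0Pr => e e0; rewrite add0r.
set Q := a * expR rate in bound.
have Q0 : 0 <= Q by rewrite mulr_ge0 ?expR_ge0 // sumr_ge0.
have Q1 : 0 < Q + 1 by lra.
have m0 : 0 < Num.min 1 (e / (Q + 1)) by rewrite lt_min ltr01 divr_gt0.
have m1 : Num.min 1 (e / (Q + 1)) <= 1 by rewrite ge_min lexx.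
rewrite (le_trans (bound _ m0 m1)) //.
have me : Num.min 1 (e / (Q + 1)) <= e / (Q + 1) by rewrite ge_min lexx orbT.
rewrite (le_trans (ler_wpM2r Q0 me)) //.
by rewrite mulrAC ler_pdivrMr // ler_wpM2l ?ltW //; lra.
Qed.

End stationarity.

(** * The law of large numbers *)

Section stationary_residual.
Context {R : realType} {M N l : nat} {c : pattern M -> R} {C K : R} {P : R -> R}.
Hypothesis c_bnd : forall xi, 0 <= c xi <= C.
Hypothesis l_gt0 : (0 < l)%N.
Hypothesis lN : (l <= N)%N.
Hypothesis MN : (M.*2 < N)%N.
Hypothesis K_ge0 : 0 <= K.
Hypothesis taylor : taylor2 (reaction c) P K.
Context {mu : probability (config N) R}.
Hypothesis mu_inv : invariant_measure c mu.

Lemma energy_noiseE (r : R) : r = N%:R / l%:R ->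
  energy_noise (N := N) (l := l) (C := C) (K := K) =
  2 * r ^+ 6 + (2 * K + C) * r ^+ 4 + C * K * r ^+ 2.
Proof.
move=> ->; rewrite /energy_noise; field.
by rewrite gt_eqF // ltr0n.
Qed.

Let n := M.*2.+1.

(** With [r] fixed, only the first term grows with [N], and it is small compared to
    [N] when [l] is. *)
Lemma stationary_residual (r : R) : N%:R <= r * l%:R ->
  \sum_eta mass mu eta * \sum_x residual c (field l eta) x ^+ 2 <=
  4 * C ^+ 2 * n%:R * (C + 4) * (3 * l + M.*2)%:R +
  12 * C ^+ 2 * n%:R ^+ 2 * r +
  2 * (2 * r ^+ 6 + (2 * K + C) * r ^+ 4 + C * K * r ^+ 2).
Proof.
move=> Nr; have C0 : 0 <= C.
  by have /andP[/le_trans h /h] := c_bnd [ffun=> false].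
have stat := invariant_stationary c_bnd mu_inv.
have N0 : (0 < N)%N by exact: leq_trans l_gt0 lN.
have l0 : 0 < l%:R :> R by rewrite ltr0n.
have tvC := sum_tv_bond (fun xi => proj1 (andP (c_bnd xi)))
  (fun xi => proj2 (andP (c_bnd xi))) (mass_ge0 mu) (mass_sum mu) stat N0.
have q_le : N%:R / l%:R <= r by rewrite ler_pdivrMr.
have q_ge0 : 0 <= N%:R / l%:R :> R by rewrite divr_ge0.
have r_ge0 : 0 <= r by exact: le_trans q_le.
have lq k : (N%:R / l%:R) ^+ k <= r ^+ k.
  by rewrite lerXn2r // nnegrE.
apply: (le_trans (residual_sqr c_bnd l_gt0 lN K_ge0 taylor (mass_ge0 mu)
  (mass_sum mu) stat)).
rewrite (energy_noiseE erefl); apply: lerD; last first.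
  rewrite ler_pM2l //; apply: lerD; [apply: lerD|]; apply: ler_wpM2l => //.
  - by rewrite addr_ge0 // mulr_ge0.
  - by rewrite mulr_ge0.
apply: (le_trans (local_equilibrium l_gt0 lN MN (spin_drift_le c_bnd)
  (mass_ge0 mu) (mass_sum mu) tvC)).
rewrite -/n; apply: lerD; first by rewrite le_eqVlt; apply/orP; left; apply/eqP; ring.
by apply: ler_wpM2l; rewrite // !mulr_ge0 ?exprn_ge0.
Qed.

End stationary_residual.

Section box_size.
Context {R : realType} {N q : nat}.
Hypothesis q_gt0 : (0 < q)%N.

Lemma box_upper : (N %/ q)%:R <= N%:R / q%:R :> R.
Proof. by rewrite ler_pdivlMr ?ltr0n // -natrM ler_nat leq_divM. Qed.

Lemma box_lower : (q <= N)%N -> N%:R <= 2 * q%:R * (N %/ q)%:R :> R.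
Proof.
move=> qN; have l_gt0 : (0 < N %/ q)%N by rewrite divn_gt0.
rewrite -!natrM ler_nat {1}(divn_eq N q); have := ltn_pmod N q_gt0; nia.
Qed.

End box_size.

Section closeness.
Context {R : realType} {M N K0 : nat} {c : pattern M -> R} {L delta : R}.
Hypothesis N_gt0 : (0 < N)%N.
Hypothesis K0_gt0 : (0 < K0)%N.
Hypothesis KN : (K0 <= N)%N.
Hypothesis L_ge0 : 0 <= L.
Hypothesis delta_gt0 : 0 < delta.

Let l := (N %/ K0)%N.

(** The field is within [delta / 8] of the solution, the averages move the test
    functions by order [1 / K0], and the lattice by order [1 / N]: each of the three
    contributions to the distance is at most [delta / 4]. *)
Lemma dist_set_lt (eta : config N) (rho : R -> R) :
  classical_solution c rho ->
  (forall u w, `|rho w - rho u| <= L * `|w - u|) ->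
  (forall x : 'I_N, `|field l eta x - rho (x%:R / N%:R)| <= delta / 8) ->
  48 * pi / delta <= K0%:R -> (8 * L + 32 * pi) / delta <= N%:R ->
  (dist_set (@empirical R N eta) (stationary_set c) < delta%:E)%E.
Proof.
move=> sol lip close K0_ge N_ge; have N0 : 0 < N%:R :> R by rewrite ltr0n.
have k0 : 0 < K0%:R :> R by rewrite ltr0n.
have cont := lipschitz_continuous lip.
have rho01 : forall u, 0 <= rho u <= 1 by case: sol.
have d8 : 0 <= delta / 8 by rewrite divr_ge0 // ltW.
have l_gt0 : (0 < l)%N by rewrite divn_gt0.
have D := dist_le N_gt0 l_gt0 cont rho01 L_ge0 d8 lip close.
apply: (@le_lt_trans _ _ (dist (@empirical R N eta) (density cont rho01))).
  apply: ereal_inf_lbound; exists (density cont rho01) => //.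
  by exists rho => //; exact: density_has_density.
apply: (le_lt_trans D); rewrite lte_fin.
have h1 : 12 * pi / K0%:R <= delta / 4.
  by move: K0_ge; rewrite ler_pdivrMr // ler_pdivrMr // => h; lra.
have h2 : (2 * L + 8 * pi) / N%:R <= delta / 4.
  by move: N_ge; rewrite ler_pdivrMr // ler_pdivrMr // => h; lra.
have h3 : l%:R / N%:R <= K0%:R^-1 :> R.
  rewrite ler_pdivrMr // (le_trans (box_upper K0_gt0)) //.
  by rewrite mulrC.
have h4 : 12 * pi * (l%:R / N%:R) <= 12 * pi / K0%:R :> R.
  by rewrite ler_wpM2l // mulr_ge0 // pi_ge0.
have -> : 2 * (L / N%:R + delta / 8) + 2 * (2 * pi * (2 + 3 * l%:R) / N%:R) =
    delta / 4 + (2 * L + 8 * pi) / N%:R + 12 * pi * (l%:R / N%:R).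
  by field; rewrite gt_eqF.
have d3 : delta / 4 + delta / 4 + delta / 4 < delta.
  rewrite (_ : _ + _ = delta * (3 / 4)); last by field.
  by rewrite gtr_pMr // ltr_pdivrMr // mul1r ltr_nat.
exact: (le_lt_trans (lerD (lerD (lexx _) h2) (le_trans h4 h1)) d3).
Qed.

End closeness.

Theorem theorem2p2 (R : realType) (M : nat) (hM : (1 <= M)%N)
    (c : pattern M -> R) (c_gt0 : forall xi : pattern M, 0 < c xi)
    (mu : forall N : nat, probability (config N) R)
    (mu_inv : forall N : nat, (M.*2 < N)%N -> invariant_measure c (mu N))
    (delta : R) (delta_gt0 : 0 < delta) :
  (fun N : nat => empirical_law (mu N)
     [set p : subprob_torus R | (delta%:E <= dist_set p (stationary_set c))%E])
    @ \oo --> 0%E.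
Proof.
pose C := \sum_xi c xi.
have c_bnd xi : 0 <= c xi <= C.
  rewrite ltW //= /C (bigD1 xi) //= lerDl sumr_ge0 // => ? _; exact: ltW.
have C0 : 0 <= C by apply: sumr_ge0 => xi _; exact: ltW.
have [p pE] := reaction_poly c.
have [P [K [K0 taylor']]] := poly_taylor2 p.
have taylor : taylor2 (reaction c) P K.
  by move=> a b ha hb; rewrite !pE; exact: taylor'.
have F_lip r s : 0 <= r <= 1 -> 0 <= s <= 1 ->
    `|reaction c s - reaction c r| <= K * `|s - r|.
  by move=> hr hs; have [] := taylor r s hr hs.
pose B := `|reaction c 0| + K.
have B0 : 0 <= B by rewrite addr_ge0.
have F_le r : 0 <= r <= 1 -> `|reaction c r| <= B.
  move=> hr; rewrite -[reaction c r](subrK (reaction c 0)) addrC.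
  rewrite (le_trans (ler_normD _ _)) // lerD2l.
  rewrite (le_trans (F_lip 0 r _ hr)) ?lexx ?ler01 // subr0 ler_piMr //.
  by case/andP: hr => r0 r1; rewrite ger0_norm.
have d8 : 0 < delta / 8 by rewrite divr_gt0.
have [k k0 [n0 solve]] := almost_solution_close F_le F_lip K0 d8.
have solve_pos N (v : 'I_N -> R) : (n0 < N)%N -> (forall x, 0 <= v x <= 1) ->
    \sum_x `|residual c v x| <= k * N%:R -> exists rho : R -> R,
    [/\ classical_solution c rho,
      forall u w, `|rho w - rho u| <= (2 * B + 2) * `|w - u| &
      forall x : 'I_N, `|v x - rho (x%:R / N%:R)| <= delta / 8].
  by case: N v => // N' v N_n0 v01 sv; exact: solve.
pose n : R := M.*2.+1%:R.
pose law N := fine (mu N [set eta |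
  (delta%:E <= dist_set (@empirical R N eta) (stationary_set c))%E]).
suff law0 : law N @[N --> \oo] --> (0 : R).
  apply: cvg_EFin; last exact: law0.
  by apply: nearW => N; rewrite /empirical_law /pushforward fin_num_measure.
apply/cvgrPdist_le => e e0.
pose a1 := 12 * C ^+ 2 * n * (C + 4) / k ^+ 2.
(* The boxes have size [N / q]: the terms of the final bound that survive when [N]
   grows with [q] fixed are of order [1 / q]. *)
near \oo => q.
have q_gt0 : (0 < q)%N by near: q; exact: nbhs_infty_gt.
have qR : 0 < q%:R :> R by rewrite ltr0n.
have q_a1 : a1 * 2 / e <= q%:R by near: q; exact: nbhs_infty_ger.
have q_pi : 48 * pi / delta <= q%:R by near: q; exact: nbhs_infty_ger.
pose r : R := 2 * q%:R.
pose a2 := (4 * C ^+ 2 * n * (C + 4) * M.*2%:R + 12 * C ^+ 2 * n ^+ 2 * r +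
  2 * (2 * r ^+ 6 + (2 * K + C) * r ^+ 4 + C * K * r ^+ 2)) / k ^+ 2.
near=> N.
have N_M : (M.*2 < N)%N by near: N; exact: nbhs_infty_gt.
have N_n0 : (n0 < N)%N by near: N; exact: nbhs_infty_gt.
have N_q : (q <= N)%N by near: N; exact: nbhs_infty_ge.
have N_a2 : a2 * 2 / e <= N%:R by near: N; exact: nbhs_infty_ger.
have N_pi : (8 * (2 * B + 2) + 32 * pi) / delta <= N%:R.
  by near: N; exact: nbhs_infty_ger.
have N_gt0 : (0 < N)%N by exact: leq_ltn_trans N_n0.
have NR : 0 < N%:R :> R by rewrite ltr0n.
rewrite sub0r normrN ger0_norm ?fine_ge0 //.
pose l := (N %/ q)%N.
have l_gt0 : (0 < l)%N by rewrite divn_gt0.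
pose h (eta : config N) :=
  (\sum_x residual c (field l eta) x ^+ 2) / (k ^+ 2 * N%:R).
have kN : 0 < k ^+ 2 * N%:R by rewrite mulr_gt0 // exprn_gt0.
have h0 eta : 0 <= h eta.
  by rewrite divr_ge0 ?(ltW kN) // sumr_ge0 // => x _; exact: sqr_ge0.
(* The bound [y <= k / 2 + y ^+ 2 / (2 * k)] passes from the squared residual to
   the sum of the residuals asked for by [solve_pos]. *)
have h1 eta : (delta%:E <= dist_set (@empirical R N eta) (stationary_set c))%E ->
    1 <= h eta.
  move=> bad; rewrite leNgt; apply/negP; rewrite ltr_pdivrMr // mul1r => small.
  have small' : \sum_x `|residual c (field l eta) x| <= k * N%:R.
    have -> : k * N%:R = k / 2 * N%:R + k ^+ 2 * N%:R / (2 * k).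
      by field; rewrite gt_eqF.
    apply: (@le_trans _ _ (\sum_x (k / 2 + residual c (field l eta) x ^+ 2 / (2 * k)))).
      apply: ler_sum => x _; rewrite -[_ ^+ 2]real_normK ?num_real //.
      set y := `|_|; rewrite -subr_ge0.
      have -> : k / 2 + y ^+ 2 / (2 * k) - y = (k - y) ^+ 2 / (2 * k).
        by field; rewrite gt_eqF.
      by rewrite divr_ge0 ?sqr_ge0 // mulr_ge0 // ltW.
    rewrite big_split /= sumr_const card_ord -[_ *+ N]mulr_natr lerD2l.
    by rewrite -mulr_suml ler_wpM2r ?invr_ge0 ?mulr_ge0 // ltW.
  have [rho [sol lip close]] := solve_pos N _ N_n0 (field01 l_gt0 eta) small'.
  have L0 : 0 <= 2 * B + 2 by rewrite addr_ge0 // mulr_ge0.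
  have := dist_set_lt N_gt0 q_gt0 N_q L0 delta_gt0 sol lip close q_pi N_pi.
  by rewrite ltNge bad.
apply: (le_trans (markov_mass (mu N) h0 h1)).
have lN : (l <= N)%N by exact: leq_div.
have S := stationary_residual c_bnd l_gt0 lN N_M K0 taylor (mu_inv N N_M)
  (box_lower (R := R) q_gt0 N_q).
rewrite /h; under eq_bigr do rewrite mulrA.
rewrite -mulr_suml (le_trans (ler_wpM2r (ltW _) S)) ?invr_gt0 //.
have lq := box_upper (R := R) (N := N) q_gt0; rewrite -/l in lq.
have T : a1 / q%:R + a2 / N%:R <= e.
  move: q_a1 N_a2; rewrite !ler_pdivrMr // => A1 A2.
  have : a1 / q%:R <= e / 2 by rewrite ler_pdivrMr //; lra.
  have : a2 / N%:R <= e / 2 by rewrite ler_pdivrMr //; lra.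
  lra.
apply: le_trans T.
have X0 : 0 <= 4 * C ^+ 2 * n * (C + 4).
  by rewrite !mulr_ge0 ?exprn_ge0 ?addr_ge0.
have lq' := ler_wpM2l X0 lq.
rewrite natrD natrM ler_pdivrMr // -/n -/r.
have -> : (a1 / q%:R + a2 / N%:R) * (k ^+ 2 * N%:R) =
    3 * (4 * C ^+ 2 * n * (C + 4) * (N%:R / q%:R)) +
    (4 * C ^+ 2 * n * (C + 4) * M.*2%:R + 12 * C ^+ 2 * n ^+ 2 * r +
     2 * (2 * r ^+ 6 + (2 * K + C) * r ^+ 4 + C * K * r ^+ 2)).
  by rewrite /a1 /a2; field; rewrite !gt_eqF.
lra.
Unshelve. all: by end_near.
Qed.
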